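(* Fix $\sigma\in[1,\infty)$, and let $y_k=k+\sigma-1$ for $k\ge1$, $x_k=k+\sigma-1$ for $k\ge2$, and either $x_1=\sigma$ or $x_1=1$ (the two shifted Plancherel specializations). For each $n$ let $w\in\mathbb{YF}_n$ be a random Fibonacci word distributed according to the clone coherent measure $$M_n(w)=\dim(w)\,\frac{s_w(\vec x\mid\vec y)}{x_1x_2\cdots x_n}.$$ Then for each fixed $k\ge1$ the hikes $(\tilde h_1(w),\ldots,\tilde h_k(w))$ satisfy the joint convergence in distribution $$\left(\frac{\tilde h_j(w)}{n-\sum_{i=1}^{j-1}\tilde h_i(w)}\right)_{j=1}^k\ \xrightarrow[n\to\infty]{d}\ (\xi_{\sigma;1},\ldots,\xi_{\sigma;k}),$$ where $\xi_{\sigma;1},\xi_{\sigma;2},\ldots$ are $[0,1]$-valued random variables with the consistent joint cumulative distribution functions, for $n\ge1$ and $\alpha_1,\ldots,\alpha_n\in[0,1]$, $$\mathbb P(\xi_{\sigma;1}\le\alpha_1,\ldots,\xi_{\sigma;n}\le\alpha_n)=\sigma^{-n+1}G(\alpha_1)\cdots G(\alpha_n)+(\sigma-1)\sum_{j=1}^{n-1}\sigma^{-n+j}\,G(\alpha_1)\cdots G(\alpha_{n-j}),$$ with $G(\alpha)=1-(1-\alpha)^{\sigma/2}$ the cumulative distribution function of the Beta distribution $\mathrm{beta}(1,\sigma/2)$.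
   Context: A Fibonacci word is a finite word $w$ in the letters $1,2$; its weight $|w|$ is the sum of its letters; $\mathbb{YF}_n$ is the set of Fibonacci words of weight $n$. $\dim$ is defined by $\dim(\varnothing)=1$, $\dim(1v)=\dim(v)$, $\dim(2v)=(|v|+1)\dim(v)$. For sequences $\vec x,\vec y$: $A_\ell$ ($A_0=1$) is the determinant of the $\ell\times\ell$ tridiagonal matrix with diagonal $x_1,\ldots,x_\ell$, superdiagonal $y_1,\ldots,y_{\ell-1}$ and subdiagonal entries $1$; $B_k(m)$ is the determinant of the $(k+1)\times(k+1)$ tridiagonal matrix with diagonal $y_{m+1},x_{m+3},\ldots,x_{m+k+2}$, superdiagonal $x_{m+1}y_{m+2},y_{m+3},\ldots,y_{m+k+1}$, subdiagonal entries $1$. Clone Schur functions: $s_{1^k}=A_k$, $s_{1^k2u}=B_k(|u|)\,s_u$. For both specializations all $s_w$ are positive and $M_n$ is a probability measure on $\mathbb{YF}_n$. Hikes: write uniquely $w=2^{h_1}12^{h_2}1\cdots12^{h_m}$ with $h_j\in\mathbb Z_{\ge0}$; then $\tilde h_j(w)=2h_j+1$ for $j\le m-1$, $\tilde h_m(w)=2h_m$, and $\tilde h_j(w)=0$ for $j>m$. A ratio with denominator $0$ is set to be $0$. *)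

(* Defs.v *)
From HB Require Import structures.
From mathcomp Require Import all_boot all_order all_algebra.
From mathcomp Require Import all_classical all_reals all_analysis.

Set Implicit Arguments.
Unset Strict Implicit.
Unset Printing Implicit Defensive.

Import Order.TTheory GRing.Theory Num.Theory.
Import numFieldNormedType.Exports.

Local Open Scope classical_set_scope.
Local Open Scope ring_scope.

(* The Boolean b encodes the letter b.+1: false is 1 and true is 2. *)
Definition fibword := seq bool.

Definition weight (w : fibword) : nat := (\sum_(b <- w) b.+1)%N.

Fixpoint YF (n : nat) : seq fibword :=
  match n with
  | 0 => [:: [::]]
  | 1 => [:: [:: false]]
  | (n'.+1 as m).+1 => map (cons false) (YF m) ++ map (cons true) (YF n')
  end.

Lemma weight_cons b w : weight (b :: w) = (b.+1 + weight w)%N.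
Proof. by rewrite /weight big_cons. Qed.

Lemma mem_YF n w : (w \in YF n) = (weight w == n).
Proof.
have inj (b : bool) : injective (@cons bool b) by move=> u v [].
have Nmem (b : bool) (u : fibword) s :
    b :: u \in map (cons (~~ b)) s = false.
  by apply/negP => /mapP [v _ []]; case: b.
elim/ltn_ind: n w => -[|[|n]] IH w.
- case: w => [|b w]; first by rewrite /weight big_nil inE.
  by rewrite weight_cons inE.
- case: w => [|b w]; first by rewrite /weight big_nil inE.
  rewrite inE weight_cons; case: b => //=.
  by rewrite add1n eqSS -(IH 0%N) // inE; case: w.
- have -> : YF n.+2 = map (cons false) (YF n.+1) ++ map (cons true) (YF n) by [].
  rewrite mem_cat; case: w => [|[] w].
  + rewrite /weight big_nil; apply/negP => /orP[] /mapP[] //.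
  + by rewrite (Nmem true) /= mem_map // IH // weight_cons add2n !eqSS.
  + by rewrite (Nmem false) orbF mem_map // IH // weight_cons add1n eqSS.
Qed.

Lemma YF_uniq n : uniq (YF n).
Proof.
have inj (b : bool) : injective (@cons bool b) by move=> u v [].
elim/ltn_ind: n => -[|[|n]] IH //.
have -> : YF n.+2 = map (cons false) (YF n.+1) ++ map (cons true) (YF n) by [].
rewrite cat_uniq !map_inj_uniq // !IH // andbT /=.
by apply/hasPn => _ /mapP[u _ ->]; apply/negP => /mapP[].
Qed.

Fixpoint fdim (w : fibword) : nat :=
  match w with
  | [::] => 1
  | false :: v => fdim v
  | true :: v => ((weight v).+1 * fdim v)%N
  end.

Section CloneSchur.
Variable R : comNzRingType.

(* Rows and columns are numbered from 0: the diagonal is d 0, ..., d l.-1 and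
   the superdiagonal is u 0, ..., u l.-2. *)
Definition tridiag (l : nat) (d u : nat -> R) : 'M[R]_l :=
  \matrix_(i < l, j < l)
    if j == i :> nat then d i
    else if j == i.+1 :> nat then u i
    else if i == j.+1 :> nat then 1
    else 0.

(* The sequences x and y are indexed from 1; x 0 and y 0 are never used. *)
Variables x y : nat -> R.

Definition cloneA (l : nat) : R :=
  \det (tridiag l (fun i => x i.+1) (fun i => y i.+1)).

Definition cloneB (k m : nat) : R :=
  \det (tridiag k.+1
    (fun i => if i == 0%N then y m.+1 else x (m + i + 2)%N)
    (fun i => if i == 0%N then x m.+1 * y m.+2 else y (m + i + 2)%N)).

(* clone_rec k w is the clone Schur function of the word 1^k w. *)
Fixpoint clone_rec (k : nat) (w : fibword) : R :=
  match w with
  | [::] => cloneA k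
  | false :: v => clone_rec k.+1 v
  | true :: u => cloneB k (weight u) * clone_rec 0 u
  end.

Definition cloneS (w : fibword) : R := clone_rec 0 w.

Lemma cloneS_ones k : cloneS (nseq k false) = cloneA k.
Proof.
suff rec m : clone_rec m (nseq k false) = cloneA (m + k)%N by exact: rec.
elim: k m => [|k IH] m /=; first by rewrite addn0.
by rewrite IH addSnnS.
Qed.

Lemma cloneS_ones_two k u :
  cloneS (nseq k false ++ true :: u) = cloneB k (weight u) * cloneS u.
Proof.
suff rec m : clone_rec m (nseq k false ++ true :: u) =
    cloneB (m + k)%N (weight u) * cloneS u by exact: rec.
elim: k m => [|k IH] m /=; first by rewrite addn0.
by rewrite IH addSnnS.
Qed.

End CloneSchur.

Definition cloneM (R : realType) (x y : nat -> R) (n : nat) (w : fibword) : R :=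
  (fdim w)%:R * (cloneS x y w / \prod_(1 <= i < n.+1) x i).

Fixpoint runs2_rec (h : nat) (w : fibword) : seq nat :=
  match w with
  | [::] => [:: h]
  | true :: v => runs2_rec h.+1 v
  | false :: v => h :: runs2_rec 0 v
  end.

(* The sequence [:: h_1; ...; h_m] with w = 2^{h_1} 1 2^{h_2} 1 ... 1 2^{h_m}. *)
Definition runs2 (w : fibword) : seq nat := runs2_rec 0 w.

Lemma runs2_twos h : runs2 (nseq h true) = [:: h].
Proof.
suff rec m : runs2_rec m (nseq h true) = [:: (m + h)%N] by exact: rec.
elim: h m => [|h IH] m /=; first by rewrite addn0.
by rewrite IH addSnnS.
Qed.

Lemma runs2_twos_one h v :
  runs2 (nseq h true ++ false :: v) = h :: runs2 v.
Proof.
suff rec m : runs2_rec m (nseq h true ++ false :: v) = (m + h)%N :: runs2 v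
  by exact: rec.
elim: h m => [|h IH] m /=; first by rewrite addn0.
by rewrite IH addSnnS.
Qed.

(* Hikes are numbered from 0: hike w j is the (j+1)-st hike of the text. The
   Boolean, read as 0 or 1, says that a letter 1 follows the block of 2s; past
   the last block both terms vanish. *)
Definition hike (w : fibword) (j : nat) : nat :=
  ((nth 0 (runs2 w) j).*2 + (j.+1 < size (runs2 w)))%N.

(* In a field z / 0 = 0, which is the convention wanted for these ratios. *)
Definition hike_ratios (R : realType) (k n : nat) (w : fibword) : 'rV[R]_k :=
  \row_(j < k) ((hike w j)%:R / (n%:R - \sum_(i < j) (hike w i)%:R)).

Definition Gcdf (R : realType) (sigma alpha : R) : R :=
  1 - (1 - alpha) `^ (sigma / 2).

(* alpha 0, ..., alpha n.-1 are the arguments of the joint distribution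
   function of the first n variables. *)
Definition xi_cdf (R : realType) (sigma : R) (n : nat) (alpha : nat -> R) : R :=
  sigma ^- n.-1 * \prod_(i < n) Gcdf sigma (alpha i)
  + (sigma - 1) * \sum_(1 <= j < n)
      sigma ^- (n - j) * \prod_(i < n - j) Gcdf sigma (alpha i).

Section Convergence.
Local Open Scope ereal_scope.

(* Convergence in distribution (against bounded continuous test functions) of
   X n w, where w is a random word of weight n with law M n, to Y. *)
Definition words_cvg_in_distribution (R : realType) (k : nat)
    (M : nat -> fibword -> R) (X : nat -> fibword -> 'rV[R]_k)
    (d : measure_display) (T : measurableType d) (P : probability T R)
    (Y : T -> 'rV[R]_k) : Prop :=
  forall f : 'rV[R]_k -> R,
    continuous f -> (exists C : R, forall v, (`|f v| <= C)%R) ->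
    (fun n : nat => (\sum_(w <- YF n) M n w * f (X n w))%R%:E) @ \oo
      --> 'E_P[f \o Y].

End Convergence.

(* Main.v *)
(* For m >= 1 one has B_k(m) = m + sigma, whatever k is.  Hence
   M_n(2 v) = (n - 1) / (n + sigma - 1) M_{n-2}(v) for n >= 3, and the tail of the
   first ratio is a product of such factors, which tends to
   (1 - alpha)^(sigma / 2).  After the letter 1 that closes a hike, the next
   letter is 2 with probability close to 1 / sigma, and the word starts afresh;
   otherwise it is 1, and then 1s follow up to probability O(1 / n), so that the
   remaining ratios vanish in the limit.  The limit sequence is thus made of
   independent beta(1, sigma / 2) variables up to a geometric time, and of zeros
   from then on.  It is realized on [0, 1]: the binary digits of a uniform number
   at even and at odd positions give two independent uniform numbers, and
   iterating this on the second one yields an i.i.d. sequence.  Convergence of the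
   joint distribution functions at points of ]0, 1]^k is enough for weak
   convergence: a continuous function on the cube is uniformly close to a
   combination of indicators of grid cells. *)

Require Import Defs.
From HB Require Import structures.
From mathcomp Require Import all_boot all_order all_algebra.
From mathcomp Require Import all_classical all_reals all_analysis.
From mathcomp Require Import measurable_realfun.
From mathcomp Require Import ring lra zify.

Set Implicit Arguments.
Unset Strict Implicit.
Unset Printing Implicit Defensive.

Import Order.TTheory GRing.Theory Num.Theory.
Import numFieldNormedType.Exports.

Local Open Scope classical_set_scope.
Local Open Scope ring_scope.

(** * Clone Schur functions and the clone measure *)

(** Everything exact rests on x_{j+1} = y_j + 1 for j >= 1: it turns the three-term recursions of A
    and B into first-order ones for their increments, solved by constants or products. The two
    specializations are treated together under 1 <= x_1 <= sigma. The value x_1 enters only through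
    A_l and B_k(0), which have no common simple form; their masses are only ever used in total. The
    limits are derived from four facts alone: nonnegativity, total mass 1, and two exact ratios for
    words containing a 2 followed by a nonempty word. Level 0 has to be avoided: a run of 1s
    produces ratios 1 / N, positive for every n but 0 in the limit, so distribution functions need
    not converge there. What happens after a closing 1 is only controlled at large remaining weight.
    That is enough, since the weight left by a hike stays below a fixed bound with vanishing
    probability. *)

Section Continuants.
Variable R : comNzRingType.
Implicit Types d u : nat -> R.

Definition continuant l d u : R := \det (tridiag l d u).

Local Notation K := continuant.

Lemma tridiag0 d u : K 0 d u = 1.
Proof. exact: det_mx00. Qed.

Lemma tridiag1 d u : K 1 d u = d 0%N.
Proof. by rewrite /continuant (det_mx11 (tridiag 1 d u)) mxE. Qed.

Lemma tridiag_first l d u :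
  K l.+2 d u = d 0%N * K l.+1 (d \o S) (u \o S)
               - u 0%N * K l (d \o (S \o S)) (u \o (S \o S)).
Proof.
rewrite [LHS](expand_det_row _ ord0) !big_ord_recl big1 => [|i _]; last first.
  by rewrite mxE /= mul0r.
rewrite addr0 !mxE /= /cofactor /= expr0 expr1 mul1r.
congr (_ * _ + _); first by congr (\det _); apply/matrixP => i j; rewrite !mxE.
rewrite mulN1r mulrN; congr (- (_ * _)).
rewrite (expand_det_col _ ord0) big_ord_recl big1 => [|i _]; last first.
  by rewrite !mxE /= mul0r.
rewrite addr0 !mxE /= mul1r /cofactor /= expr0 mul1r.
by congr (\det _); apply/matrixP => i j; rewrite !mxE.
Qed.

Lemma tridiag_last l d u :
  K l.+2 d u = d l.+1 * K l.+1 d u - u l * K l d u.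
Proof.
elim/ltn_ind: l d u => -[|[|l]] IH d u.
- by rewrite tridiag_first !tridiag1 !tridiag0 /=; ring.
- by clear IH; rewrite !tridiag_first !tridiag1 !tridiag0 /=; ring.
- rewrite tridiag_first (IH l.+1) // (IH l _ (d \o (S \o S))) //
  (tridiag_first l.+1 d) (tridiag_first l d) /=.
  by clear IH; ring.
Qed.

Lemma cloneA0 (x y : nat -> R) : cloneA x y 0 = 1.
Proof. exact: tridiag0. Qed.

Lemma cloneA1 (x y : nat -> R) : cloneA x y 1 = x 1%N.
Proof. exact: tridiag1. Qed.

Lemma cloneA_rec (x y : nat -> R) l :
  cloneA x y l.+2 = x l.+2 * cloneA x y l.+1 - y l.+1 * cloneA x y l.
Proof. exact: tridiag_last. Qed.

Lemma cloneB0 (x y : nat -> R) m : cloneB x y 0 m = y m.+1.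
Proof. exact: tridiag1. Qed.

Lemma cloneB1 (x y : nat -> R) m :
  cloneB x y 1 m = x m.+3 * y m.+1 - x m.+1 * y m.+2.
Proof.
by rewrite /cloneB -!/(continuant _ _ _) tridiag_last tridiag1 tridiag0 /= mulr1 addn1 addn2.
Qed.

Lemma cloneB_rec (x y : nat -> R) k m :
  cloneB x y k.+2 m =
  x (m + k + 4)%N * cloneB x y k.+1 m - y (m + k + 3)%N * cloneB x y k m.
Proof.
rewrite /cloneB -!/(continuant _ _ _) tridiag_last /=.
have -> : (m + k.+2 + 2 = m + k + 4)%N by lia.
by have -> : (m + k.+1 + 2 = m + k + 3)%N by lia.
Qed.

End Continuants.

(** * The shifted Plancherel specializations: increments, normalization and exact ratios *)

Section Plancherel.
Variables (R : realType) (sigma : R) (x y : nat -> R).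
Hypothesis hsigma : 1 <= sigma.
Hypothesis hy : forall k, (1 <= k)%N -> y k = k%:R + sigma - 1.
Hypothesis hx : forall k, (2 <= k)%N -> x k = k%:R + sigma - 1.
Hypothesis hx1 : 1 <= x 1%N <= sigma.

Lemma yS k : y k.+1 = k%:R + sigma.
Proof. by rewrite hy // -natr1; ring. Qed.

Lemma xSS k : x k.+2 = k.+1%:R + sigma.
Proof. by rewrite hx // -natr1; ring. Qed.

Lemma xS_gt0 k : 0 < x k.+1.
Proof.
case: k => [|k]; first by apply: lt_le_trans (andP hx1).1.
by rewrite xSS ltr_wpDl // (lt_le_trans _ hsigma).
Qed.

(** Since x_{m+k+4} = y_{m+k+3} + 1, constants in k solve the recursion. The start B_1(m) = B_0(m)
    needs x_{m+1} = y_{m+1}, which at index 1 holds only for x_1 = sigma; hence [m.+1]. *)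
Lemma cloneB_const k m : cloneB x y k m.+1 = m.+1%:R + sigma.
Proof.
elim/ltn_ind: k => -[|[|k]] IH; first by rewrite cloneB0 yS.
  by rewrite cloneB1 !xSS !yS -!natr1; ring.
rewrite cloneB_rec !IH // (_ : (m.+1 + k + 4 = (m + k + 3).+2)%N); last lia.
rewrite (_ : (m.+1 + k + 3 = (m + k + 3).+1)%N); last lia.
by rewrite xSS yS -(natr1 (m + k + 3)); ring.
Qed.

Definition prodx n : R := \prod_(1 <= i < n.+1) x i.

Lemma prodxS n : prodx n.+1 = prodx n * x n.+1.
Proof. by rewrite /prodx big_nat_recr. Qed.

Lemma prodx0 : prodx 0 = 1.
Proof. by rewrite /prodx big_geq. Qed.

Lemma prodx_gt0 n : 0 < prodx n.
Proof.
by elim: n => [|n IH]; rewrite ?prodx0 // prodxS mulr_gt0 // xS_gt0.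
Qed.

Let sigma_gt0 : 0 < sigma. Proof. exact: lt_le_trans hsigma. Qed.

Definition shiftfact j n : R := \prod_(j <= i < n) (i%:R + sigma).

Lemma shiftfact_ge0 j n : 0 <= shiftfact j n.
Proof.
by apply: prodr_ge0 => i _; rewrite addr_ge0 // ltW.
Qed.

Lemma prodx_shiftfact n : prodx n.+1 = x 1%N * shiftfact 1 n.+1.
Proof.
elim: n => [|n IH]; first by rewrite prodxS prodx0 /shiftfact big_geq // mulr1 mul1r.
by rewrite prodxS IH xSS /shiftfact [in RHS]big_nat_recr //= mulrA.
Qed.

(** The recursion reads A_{l+2} - A_{l+1} = y_{l+1} (A_{l+1} - A_l), so the increments form a
    product; likewise for B_k(0) below. *)
Lemma cloneA_incr n :
  cloneA x y n.+1 - cloneA x y n = (x 1%N - 1) * shiftfact 0 n.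
Proof.
elim: n => [|n IH]; first by rewrite cloneA1 cloneA0 /shiftfact big_geq // mulr1.
rewrite cloneA_rec xSS yS /shiftfact big_nat_recr //= mulrA.
by rewrite -/(shiftfact 0 n) -IH -natr1; ring.
Qed.

Lemma cloneB_incr n :
  cloneB x y n.+1 0 - cloneB x y n 0 = (sigma - x 1%N) * shiftfact 1 n.+2.
Proof.
elim: n => [|n IH].
  by rewrite cloneB1 cloneB0 xSS !yS /shiftfact big_nat1; ring.
rewrite cloneB_rec (_ : (0 + n + 4 = n.+4)%N); last lia.
rewrite (_ : (0 + n + 3 = n.+3)%N); last lia.
rewrite xSS yS /shiftfact big_nat_recr //= mulrA.
by rewrite -/(shiftfact 1 n.+2) -IH -(natr1 n.+2); ring.
Qed.

Lemma cloneA_ge0 n : 0 <= cloneA x y n.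
Proof.
elim: n => [|n IH]; first by rewrite cloneA0.
have -> : cloneA x y n.+1 = (cloneA x y n.+1 - cloneA x y n) + cloneA x y n.
  by rewrite subrK.
by rewrite addr_ge0 // cloneA_incr mulr_ge0 ?shiftfact_ge0 // subr_ge0 (andP hx1).1.
Qed.

Lemma cloneB_ge0 k m : 0 <= cloneB x y k m.
Proof.
case: m => [|m]; last by rewrite cloneB_const addr_ge0 // ltW.
elim: k => [|n IH]; first by rewrite cloneB0 yS addr_ge0 // ltW.
have -> : cloneB x y n.+1 0 = (cloneB x y n.+1 0 - cloneB x y n 0) + cloneB x y n 0.
  by rewrite subrK.
by rewrite addr_ge0 // cloneB_incr mulr_ge0 ?shiftfact_ge0 // subr_ge0 (andP hx1).2.
Qed.

Lemma clone_rec_ge0 w k : 0 <= clone_rec x y k w.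
Proof.
elim: w k => [|[] w IH] k /=; [exact: cloneA_ge0| |exact: IH].
by rewrite mulr_ge0 ?cloneB_ge0.
Qed.

Lemma sum_YFSS (f : fibword -> R) n :
  \sum_(w <- YF n.+2) f w =
  \sum_(v <- YF n.+1) f (false :: v) + \sum_(u <- YF n) f (true :: u).
Proof.
have -> : YF n.+2 = map (cons false) (YF n.+1) ++ map (cons true) (YF n) by [].
by rewrite big_cat !big_map.
Qed.

Lemma big_YF_weight (f g : fibword -> R) n :
  (forall w, weight w = n -> f w = g w) ->
  \sum_(w <- YF n) f w = \sum_(w <- YF n) g w.
Proof.
by move=> fg; apply: eq_big_seq => w; rewrite mem_YF => /eqP; exact: fg.
Qed.

Definition clone_sum j n : R :=
  \sum_(v <- YF n) (fdim v)%:R * clone_rec x y j v.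

Lemma clone_sumSS j n : clone_sum j n.+2 =
  clone_sum j.+1 n.+1 + n.+1%:R * cloneB x y j n * clone_sum 0 n.
Proof.
rewrite /clone_sum sum_YFSS; congr (_ + _).
rewrite mulr_sumr; apply: big_YF_weight => u /= ->.
by rewrite natrM; ring.
Qed.

(** The clone Schur functions of 1^(n+2) and 1^n 2, both words of dimension 1: the only ones of this
    weight whose value can change when 1s are prepended. *)
Definition hookpart n : R := cloneA x y n.+2 + cloneB x y n 0.

(** The two increments combine through (x_1 - 1) sigma + (sigma - x_1) = x_1 (sigma - 1), and x_1 is
    the factor that completes the product. *)
Lemma hookpart_incr n : hookpart n.+1 - hookpart n = (sigma - 1) * prodx n.+2.
Proof.
have -> : hookpart n.+1 - hookpart n =
   (cloneA x y n.+3 - cloneA x y n.+2) + (cloneB x y n.+1 0 - cloneB x y n 0).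
  by rewrite /hookpart; ring.
rewrite cloneA_incr cloneB_incr prodx_shiftfact /shiftfact.
by rewrite (big_ltn (m := 0)) // add0r; ring.
Qed.

(** Prepending j ones does not change the value at 1^i 2 u with u nonempty, so [clone_sum j] and
    [clone_sum 0] differ by a shift of [hookpart] only. General j is needed because splitting off a
    letter 1 raises j; j = 0 is the normalization of the measure. *)
Lemma clone_sumE n : (clone_sum 0 n = prodx n) *
  (forall j, clone_sum j n.+2 = prodx n.+2 + hookpart (n + j) - hookpart n).
Proof.
have base j : clone_sum j 0 = cloneA x y j.
  by rewrite /clone_sum /= big_seq1 /= mul1r.
have base1 j : clone_sum j 1 = cloneA x y j.+1.
  by rewrite /clone_sum /= big_seq1 /= mul1r.
elim/ltn_ind: n => n IH.
have s0 : clone_sum 0 n = prodx n.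
  case: n IH => [|[|n]] IH; first by rewrite base cloneA0 prodx0.
    by rewrite base1 cloneA1 prodxS prodx0 mul1r.
  by rewrite (IH n) // addn0; ring.
split=> // j; rewrite clone_sumSS s0; case: n IH s0 => [|n] IH s0.
  rewrite base1 prodx0 /hookpart !prodxS prodx0 add0n.
  by rewrite (cloneA_rec x y 0) cloneA1 cloneA0 (cloneB0 x y 0) xSS yS; ring.
rewrite (IH n) // cloneB_const addSnnS.
rewrite (prodxS n.+2) xSS (prodxS n.+1) xSS.
have := hookpart_incr n; rewrite (prodxS n.+1) xSS -(natr1 n.+1).
by move/eqP; rewrite subr_eq => /eqP ->; ring.
Qed.

Local Notation M := (cloneM x y).

Lemma cloneM_ge0 n w : 0 <= M n w.
Proof.
by rewrite /cloneM mulr_ge0 // divr_ge0 ?clone_rec_ge0 // ltW // prodx_gt0.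
Qed.

Lemma cloneM_sum n : \sum_(w <- YF n) M n w = 1.
Proof.
under eq_bigr do rewrite /cloneM mulrA.
rewrite -mulr_suml -/(prodx n) -/(clone_sum 0 n) clone_sumE divff //.
by rewrite gt_eqF // prodx_gt0.
Qed.

(** The factor B_0(|u|) = |u| + sigma cancels x_{n+2}, leaving (|u| + 1) / x_{n+3}. *)
Lemma cloneM_two n u : weight u = n.+1 ->
  M n.+3 (true :: u) = n.+2%:R / (n.+2%:R + sigma) * M n.+1 u.
Proof.
move=> wu; rewrite /cloneM -!/(prodx _) /cloneS /= wu cloneB_const.
rewrite !(prodxS n.+2) !(prodxS n.+1) !xSS natrM.
have p0 : prodx n.+1 != 0 by rewrite gt_eqF // prodx_gt0.
have h1 : n.+1%:R + sigma != 0 by rewrite gt_eqF // ltr_wpDl.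
have h2 : n.+2%:R + sigma != 0 by rewrite gt_eqF // ltr_wpDl.
move: (n.+1%:R + sigma) (n.+2%:R + sigma) (prodx n.+1) h1 h2 p0 => a b p a0 b0 p0.
by field; rewrite ?a0 ?b0 ?p0.
Qed.

(** B does not see the number of leading 1s, so one more of them only adds a factor to the
    normalization. *)
Lemma cloneM_one_ones_two n i u : weight u = n.+1 ->
  M (n + i).+4 (nseq i.+1 false ++ true :: u) =
  M (n + i).+3 (nseq i false ++ true :: u) / ((n + i).+3%:R + sigma).
Proof.
move=> wu; rewrite /cloneM -!/(prodx _) !cloneS_ones_two wu !cloneB_const.
rewrite (prodxS (n + i).+3) xSS.
have -> : fdim (nseq i.+1 false ++ true :: u) = fdim (nseq i false ++ true :: u) by [].
have p0 : prodx (n + i).+3 != 0 by rewrite gt_eqF // prodx_gt0.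
have h1 : (n + i).+3%:R + sigma != 0 by rewrite gt_eqF // ltr_wpDl.
move: ((n + i).+3%:R + sigma) (prodx (n + i).+3) h1 p0 => a p a0 p0.
by field; rewrite ?a0 ?p0.
Qed.

End Plancherel.

(** * Hikes *)

(** Iterating it turns the denominators of the ratios into weights, so that statements on k hikes go
    by induction on k. *)
Fixpoint after_hike (w : fibword) : fibword :=
  match w with
  | [::] => [::]
  | false :: v => v
  | true :: v => after_hike v
  end.

Lemma weight_nil : weight [::] = 0%N.
Proof. by rewrite /weight big_nil. Qed.

Lemma runs2_rec_shift h w :
  runs2_rec h w = (h + head 0 (runs2 w))%N :: behead (runs2 w).
Proof.
rewrite /runs2; elim: w h => [|[] w IH] h /=; rewrite ?addn0 //.
by rewrite (IH h.+1) (IH 1%N) /= addnA addn1.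
Qed.

Lemma size_runs2 w : (0 < size (runs2 w))%N.
Proof. by rewrite /runs2 runs2_rec_shift. Qed.

Lemma runs2_true w :
  runs2 (true :: w) = (head 0 (runs2 w)).+1 :: behead (runs2 w).
Proof. by rewrite /runs2 /= runs2_rec_shift. Qed.

Lemma runs2_false w : runs2 (false :: w) = 0%N :: runs2 w.
Proof. by []. Qed.

Lemma hike_true0 w : hike (true :: w) 0 = (hike w 0).+2.
Proof.
rewrite /hike runs2_true; have := size_runs2 w.
by case: (runs2 w) => //= a l _; rewrite doubleS.
Qed.

Lemma hike_trueS w j : hike (true :: w) j.+1 = hike w j.+1.
Proof.
rewrite /hike runs2_true; have := size_runs2 w.
by case: (runs2 w).
Qed.

Lemma hike_false0 w : hike (false :: w) 0 = 1%N.
Proof. by rewrite /hike runs2_false /= ltnS size_runs2. Qed.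

Lemma hike_nil j : hike [::] j = 0%N.
Proof. by case: j => [|j] //; rewrite /hike /= nth_nil. Qed.

Lemma hike0_after w : (hike w 0 + weight (after_hike w) = weight w)%N.
Proof.
elim: w => [|[] w IH]; first by rewrite hike_nil weight_nil.
  by rewrite hike_true0 weight_cons -IH.
by rewrite hike_false0 weight_cons.
Qed.

Lemma hikeS w j : hike w j.+1 = hike (after_hike w) j.
Proof.
elim: w => [|[] w IH]; first by rewrite !hike_nil.
  by rewrite hike_trueS IH.
by rewrite /hike runs2_false.
Qed.

Lemma weight_after_hike w : (weight (after_hike w) <= (weight w).-1)%N.
Proof.
elim: w => [|[] w IH]; [by rewrite weight_nil| |by rewrite /= weight_cons].
by rewrite weight_cons /=; apply: leq_trans IH _; lia.
Qed.

Section HikeRatios.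
Variable R : realType.

Definition hike_ratio (w : fibword) (j : nat) : R :=
  (hike w j)%:R / ((weight w)%:R - \sum_(i < j) (hike w i)%:R).

Lemma hike_ratio0 w : hike_ratio w 0 = (hike w 0)%:R / (weight w)%:R.
Proof. by rewrite /hike_ratio big_ord0 subr0. Qed.

Lemma hike_ratioS w j : hike_ratio w j.+1 = hike_ratio (after_hike w) j.
Proof.
rewrite /hike_ratio hikeS big_ord_recl -(hike0_after w) natrD; congr (_ / _).
rewrite opprD addrA [_%:R + _]addrC addrK; congr (_ - _).
by apply: eq_bigr => i _; rewrite hikeS.
Qed.

Lemma hike_ratio_itv w j : 0 <= hike_ratio w j <= 1.
Proof.
elim: j w => [|j IH] w; last by rewrite hike_ratioS.
rewrite hike_ratio0 divr_ge0 //=.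
have [->|w0] := eqVneq (weight w) 0%N; first by rewrite invr0 mulr0.
rewrite ler_pdivrMr ?ltr0n ?lt0n // mul1r ler_nat.
by rewrite -(hike0_after w) leq_addr.
Qed.

(** The bound h / N <= a is written (1 - a) N <= N - h, a condition on the remaining weight, free of
    division and of running sums. *)
Fixpoint hikes_le (s : seq R) (w : fibword) : bool :=
  if s is a :: s' then
    ((1 - a) * (weight w)%:R <= (weight (after_hike w))%:R) &&
    hikes_le s' (after_hike w)
  else true.

Lemma mkseq_cons (T : Type) (f : nat -> T) k :
  mkseq f k.+1 = f 0%N :: mkseq (f \o S) k.
Proof. by rewrite /mkseq /= -[1%N]addn0 iotaDl -map_comp. Qed.

Lemma hike_ratio_le0 a w : 0 <= a ->
  (hike_ratio w 0 <= a) = ((1 - a) * (weight w)%:R <= (weight (after_hike w))%:R).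
Proof.
move=> a0; rewrite hike_ratio0.
have := hike0_after w.
have [->|w0] := eqVneq (weight w) 0%N.
  by move=> /eqP; rewrite addn_eq0 => /andP[/eqP -> /eqP ->]; rewrite invr0 !mulr0 a0 lexx.
move=> <-; rewrite ler_pdivrMr; last by rewrite hike0_after ltr0n lt0n.
by rewrite natrD; apply/idP/idP; lra.
Qed.

Lemma hikes_leP k (alpha : nat -> R) w :
  (forall j, (j < k)%N -> 0 <= alpha j) ->
  reflect (forall j, (j < k)%N -> hike_ratio w j <= alpha j)
          (hikes_le (mkseq alpha k) w).
Proof.
elim: k alpha w => [|k IH] alpha w a0; first by apply: (iffP idP).
rewrite mkseq_cons /= -hike_ratio_le0 ?a0 //.
have a1 : forall j, (j < k)%N -> 0 <= (alpha \o S) j by move=> j jk; exact: a0.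
have IHw := IH _ (after_hike w) a1.
apply: (iffP andP) => [[h0 /IHw h1] [|j] jk //|h].
  by rewrite hike_ratioS h1.
by split; [exact: h|apply/IHw => j jk; rewrite -hike_ratioS h].
Qed.

(** Each leading 1 is a hike of length 1, whose ratio 1 / W with W >= m is below every level a such
    that a m >= 1. *)
Lemma hikes_le_ones s v m : (forall a, a \in s -> 1 <= a * m%:R) ->
  (m <= weight v)%N -> hikes_le s (nseq (size s) false ++ v).
Proof.
elim: s => [|a s IH] //= sm mv; rewrite IH ?andbT //; last first.
  by move=> b bs; rewrite sm // inE bs orbT.
rewrite weight_cons natrD; set W := weight _.
rewrite [false.+1%:R](_ : _ = 1) //.
have mW : m%:R <= W%:R :> R.
  by rewrite ler_nat (leq_trans mv) // /W /weight big_cat leq_addl.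
have am := sm a (mem_head _ _).
have : 0 <= a.
  rewrite leNgt; apply/negP => a0.
  have : a * m%:R <= 0 by rewrite nmulr_rle0.
  by move: am; lra.
by move=> a0; have := ler_wpM2l a0 mW; lra.
Qed.

End HikeRatios.

(** * Limits of the distribution functions of the hikes *)

Section RealLimits.
Variable R : realType.

Lemma powR_expR_ln (a p : R) : 0 < a -> a `^ p = expR (p * ln a).
Proof. by move=> a0; rewrite /powR gt_eqF. Qed.

Lemma cvg_powR (u : nat -> R) (l p : R) : 0 < l ->
  u n @[n --> \oo] --> l -> (u n) `^ p @[n --> \oo] --> l `^ p.
Proof.
move=> l0 ul; rewrite (powR_expR_ln _ l0).
have E : \forall n \near \oo, expR (p * ln (u n)) = u n `^ p.
  near=> n; rewrite powR_expR_ln //.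
  by near: n; exact: (cvgr_gt l ul).
apply: (cvg_trans (near_eq_cvg E)).
apply: (continuous_cvg _ (@continuous_expR R _)).
apply: cvgM; first exact: cvg_cst.
by apply: (continuous_cvg _ (continuous_ln l0)).
Unshelve. all: by end_near. Qed.

Lemma cvg_div_natD (C c : R) : C / (n%:R + c) @[n --> \oo] --> 0.
Proof.
apply/cvgr0Pnorm_le => e e0; near=> n.
have n1 : `|C| / e + 1 - c <= n%:R by near: n; exact: nbhs_infty_ger.
have Ce : 0 <= `|C| / e by rewrite divr_ge0 // ltW.
have nc : 0 < n%:R + c by lra.
rewrite normrM normfV (gtr0_norm nc) ler_pdivrMr // mulrC -ler_pdivrMr //.
by lra.
Unshelve. all: by end_near. Qed.

Lemma cvg_linear_div (a b c : R) : (a * n%:R + b) / (n%:R + c) @[n --> \oo] --> a.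
Proof.
have E : \forall n \near \oo,
    a + (b - a * c) / (n%:R + c) = (a * n%:R + b) / (n%:R + c).
  near=> n.
  have n1 : 1 - c <= n%:R by near: n; exact: nbhs_infty_ger.
  have nc : n%:R + c != 0 by rewrite gt_eqF //; lra.
  by field.
apply: (cvg_trans (near_eq_cvg E)).
have := cvgD (@cvg_cst _ a _ \oo _) (cvg_div_natD (b - a * c) c).
rewrite addr0; exact.
Unshelve. all: by end_near. Qed.

Lemma powR_le_mono (a b p : R) : 0 <= p -> 0 <= a -> a <= b -> a `^ p <= b `^ p.
Proof.
move=> p0 a0 ab; apply: ge0_ler_powR; rewrite ?nnegrE //.
exact: le_trans ab.
Qed.

(* With p = s/2, both bounds compare with exp(-s/K), using 1 + z <= exp z and
   ln(1 + z) <= z. *)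
Lemma ratio_ge_powR (s K : R) : 0 <= s -> 2 < K ->
  ((K - 2) / K) `^ (s / 2) <= K / (K + s).
Proof.
move=> s0 K2; have K0 : 0 < K by lra.
have b0 : 0 < (K - 2) / K by rewrite divr_gt0 //; lra.
have Ks : 0 < K + s by lra.
apply: (@le_trans _ _ (expR (- (s / K)))).
  rewrite powR_expR_ln // ler_expR.
  have -> : - (s / K) = (s / 2) * (- (2 / K)) by field; rewrite gt_eqF.
  rewrite ler_wpM2l ?divr_ge0 //.
  have -> : (K - 2) / K = 1 + (- (2 / K)) by field; rewrite gt_eqF.
  by apply: le_ln1Dx; rewrite ltrN2 ltr_pdivrMr // mul1r.
rewrite expRN -[leRHS]invrK lef_pV2 ?posrE ?expR_gt0 ?invr_gt0 ?divr_gt0 //.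
rewrite invfM invrK.
have -> : K^-1 * (K + s) = 1 + s / K by field; rewrite gt_eqF.
exact: expR_ge1Dx.
Qed.

Lemma ratio_le_powR (s K : R) : 0 < s -> 0 <= K ->
  K / (K + s) <= ((K + s) / (K + s + 2)) `^ (s / 2).
Proof.
move=> s0 K0; have Ks : 0 < K + s by lra.
have Ks2 : 0 < K + s + 2 by lra.
have b0 : 0 < (K + s) / (K + s + 2) by rewrite divr_gt0.
apply: (@le_trans _ _ (expR (- (s / (K + s))))).
  have -> : K / (K + s) = 1 + - (s / (K + s)) by field; rewrite gt_eqF.
  exact: expR_ge1Dx.
rewrite powR_expR_ln // ler_expR.
have -> : - (s / (K + s)) = (s / 2) * (- (2 / (K + s))) by field; rewrite gt_eqF.
rewrite ler_wpM2l ?divr_ge0 ?(ltW s0) //.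
rewrite -[X in ln X]invrK lnV ?posrE ?invr_gt0 // lerN2 invfM invrK.
have -> : (K + s)^-1 * (K + s + 2) = 1 + 2 / (K + s) by field; rewrite gt_eqF.
by apply: le_ln1Dx; rewrite (lt_le_trans (ltrN10 R)) // divr_ge0 // ltW.
Qed.

End RealLimits.

(** * From the four properties of the measures to the limit of the joint distribution functions *)

Section WordSums.
Variables (R : realType) (sigma : R) (M : nat -> fibword -> R).
Implicit Types (phi psi : pred fibword) (f : fibword -> R).
Hypothesis hsigma : 1 <= sigma.
Hypothesis M_ge0 : forall n w, 0 <= M n w.
Hypothesis M_sum : forall n, \sum_(w <- YF n) M n w = 1.
Hypothesis M_two : forall n u, weight u = n.+1 ->
  M n.+3 (true :: u) = n.+2%:R / (n.+2%:R + sigma) * M n.+1 u.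
Hypothesis M_ones : forall n i u, weight u = n.+1 ->
  M (n + i).+4 (nseq i.+1 false ++ true :: u) =
  M (n + i).+3 (nseq i false ++ true :: u) / ((n + i).+3%:R + sigma).

Let sigma_gt0 : 0 < sigma. Proof. exact: lt_le_trans hsigma. Qed.
Let Dgt0 n : 0 < n%:R + sigma. Proof. by rewrite ltr_wpDl. Qed.
Let Dneq0 n : n%:R + sigma != 0. Proof. by rewrite gt_eqF. Qed.

Definition expect n phi : R := \sum_(w <- YF n) M n w * (phi w)%:R.

(** Not normalized: conditional statements compare it with its value at [xpredT]. *)
Definition expect_after_one n phi : R :=
  \sum_(v <- YF n) M n.+1 (false :: v) * (phi v)%:R.

Definition expect_after_hike n (t : R) phi : R :=
  expect n (fun w => (t <= (weight (after_hike w))%:R) && phi (after_hike w)).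

Lemma sum_YF_ones_le i n f : (forall w, 0 <= f w) ->
  \sum_(v <- YF n) f (nseq i false ++ v) <= \sum_(w <- YF (i + n)) f w.
Proof.
move=> f0; elim: i f f0 => [|i IH] f f0 //=.
apply: (le_trans (IH (fun w => f (false :: w)) (fun w => f0 _))).
case: (i + n)%N => [|m]; last first.
  by rewrite sum_YFSS lerDl sumr_ge0.
by rewrite /= !big_seq1.
Qed.

Lemma sum_YF_two_le n f : (forall w, 0 <= f w) ->
  \sum_(u <- YF n) f (true :: u) <= \sum_(w <- YF n.+2) f w.
Proof. by move=> f0; rewrite sum_YFSS lerDr sumr_ge0. Qed.

Lemma expectT n phi : (forall w, weight w = n -> phi w) -> expect n phi = 1.
Proof.
by move=> h; rewrite -(M_sum n); apply: big_YF_weight => w /h ->; rewrite mulr1.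
Qed.

Lemma expect_le1 n phi : expect n phi <= 1.
Proof.
rewrite -(M_sum n); apply: ler_sum => w _.
by rewrite ler_piMr // lern1 leq_b1.
Qed.

Lemma expect_le n phi psi :
  (forall w, weight w = n -> phi w -> psi w) -> expect n phi <= expect n psi.
Proof.
move=> h; rewrite /expect [leLHS]big_seq_cond [leRHS]big_seq_cond.
apply: ler_sum => w; rewrite andbT mem_YF => /eqP /h; case: (phi w) => [->//|_].
by rewrite mulr0 mulr_ge0.
Qed.

Lemma eq_expect n phi psi :
  (forall w, weight w = n -> phi w = psi w) -> expect n phi = expect n psi.
Proof. by move=> h; apply: big_YF_weight => w /h ->. Qed.

Lemma expect_after_one_ge0 n phi : 0 <= expect_after_one n phi.
Proof. by apply: sumr_ge0 => w _; rewrite mulr_ge0. Qed.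

Lemma expectSS n phi : expect n.+3 phi =
  expect_after_one n.+2 (fun v => phi (false :: v)) +
  n.+2%:R / (n.+2%:R + sigma) * expect n.+1 (fun u => phi (true :: u)).
Proof.
rewrite /expect sum_YFSS; congr (_ + _); rewrite mulr_sumr.
by apply: big_YF_weight => u wu; rewrite M_two // mulrA.
Qed.

(** Obtained as the complement of the words that start with 2, whose mass is (n + 2) / (n + 2 +
    sigma). *)
Lemma expect_after_oneT n :
  expect_after_one n.+2 xpredT = sigma / (n.+2%:R + sigma).
Proof.
have := expectSS n xpredT; rewrite !expectT // mulr1 => E.
rewrite (_ : expect_after_one _ _ = 1 - n.+2%:R / (n.+2%:R + sigma)); last first.
  by apply/eqP; rewrite eq_sym subr_eq -E.
by rewrite -[X in X - _](divff (Dneq0 n.+2)) -mulrBl addrC addKr.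
Qed.

(* The mass of the words 1^(j+2) 2 u is O(N^-2): their weights carry two more
   factors of order N in the denominator than those of 1^j 2 u. *)
Lemma sum_ones_two_le m j :
  \sum_(u <- YF m.+1) M (m + j).+4.+1 (nseq j.+2 false ++ true :: u) <=
  ((m + j).+3%:R + sigma)^-1 * ((m + j).+4%:R + sigma)^-1.
Proof.
have -> : \sum_(u <- YF m.+1) M (m + j).+4.+1 (nseq j.+2 false ++ true :: u) =
    (\sum_(u <- YF m.+1) M (m + j).+3 (nseq j false ++ true :: u)) *
    (((m + j).+3%:R + sigma)^-1 * ((m + j).+4%:R + sigma)^-1).
  rewrite mulr_suml; apply: big_YF_weight => u wu.
  have := M_ones j.+1 wu; rewrite addnS => ->.
  by rewrite M_ones // mulrA.
rewrite ler_piMl ?mulr_ge0 ?invr_ge0 ?(ltW (Dgt0 _)) //.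
have -> : (m + j).+3 = (j + m.+3)%N by lia.
rewrite -(M_sum (j + m.+3)).
apply: le_trans (sum_YF_ones_le _ _ (M_ge0 _)).
exact: (sum_YF_two_le _ (fun w => M_ge0 (j + m.+3) (nseq j false ++ w))).
Qed.

(** Read v letter by letter: a 2 gives a family bounded by [sum_ones_two_le], a 1 moves a unit from
    k to j at constant total weight, and after k letters 1 psi is false. So at most k families
    contribute. *)
Lemma sum_ones_defect m k j psi :
  (forall v, weight v = m.+3 -> psi (nseq (j.+2 + k) false ++ v) = false) ->
  \sum_(v <- YF (m + k).+3) M (m + k + j).+4.+1 (nseq j.+2 false ++ v) *
     (psi (nseq j.+2 false ++ v))%:R <=
  k%:R * (((m + k + j).+3%:R + sigma)^-1 * ((m + k + j).+4%:R + sigma)^-1).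
Proof.
elim: k j => [|k IH] j h.
  rewrite mul0r big_seq_cond big1 // => v; rewrite mem_YF addn0 andbT => /eqP wv.
  by move: (h v wv); rewrite addn0 => ->; rewrite mulr0.
rewrite addnS sum_YFSS -natr1 mulrDl mul1r lerD //.
- have h' v : weight v = m.+3 -> psi (nseq (j.+3 + k) false ++ v) = false.
    by move=> wv; have := h v wv; rewrite addnS.
  have := IH j.+1 h'; rewrite !addnS; apply: le_trans.
  rewrite le_eqVlt; apply/orP; left; apply/eqP; apply: eq_bigr => v _.
  have -> : nseq j.+3 false ++ v = nseq j.+2 false ++ false :: v.
    by rewrite -addn1 nseqD -catA.
  by rewrite !addSn.
- have := sum_ones_two_le (m + k).+1 j; rewrite !addSn; apply: le_trans.
  by apply: ler_sum => u _; rewrite ler_piMr // lern1 leq_b1.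
Qed.

(* After the letter 1 that closes a hike, the next letter is either 2, and the
   rest is distributed as a fresh word, or 1, and then it is almost surely
   followed by 1s only. *)
Lemma expect_after_one_approx m k phi :
  (forall v, weight v = m.+3 -> phi (nseq k.+1 false ++ v)) ->
  `|((m + k).+4%:R + sigma) * expect_after_one (m + k).+4 phi
    - (expect (m + k).+4 phi + (sigma - 1))|
  <= (k%:R + 2 * sigma) / ((m + k).+3%:R + sigma).
Proof.
move=> hphi; set n := (m + k).+4.
set D := _ + sigma; set D' := _ + sigma.
pose B phi := \sum_(v <- YF (m + k).+3) M n.+1 (false :: false :: v) * (phi (false :: v))%:R.
(* A word 1 2 u has mass M(2 u) / D, so the words starting with 12, scaled by D, reproduce the part
   of [expect n f] carried by words starting with 2; the part starting with 1 is subtracted. *)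
have split2 (f : pred fibword) : D * expect_after_one n f = expect n f
    - expect_after_one (m + k).+3 (fun v => f (false :: v)) + D * B f.
  rewrite /expect_after_one sum_YFSS mulrDr addrC; congr (_ + _).
  rewrite /expect [in RHS]sum_YFSS [X in _ = X - _]addrC addrK mulr_sumr.
  apply: big_YF_weight => u wu; rewrite mulrA; congr (_ * _).
  have := M_ones 0 wu; rewrite addn0 /= => ->.
  by rewrite mulrC divfK // Dneq0.
have D0 : 0 < D by exact: Dgt0.
have D'0 : 0 < D' by exact: Dgt0.
(* The mass of the words starting with 11 is read off the identity at the always true predicate. *)
have BT : D * B xpredT = sigma - 1 + sigma / D'.
  have := split2 xpredT; rewrite expectT // !expect_after_oneT -/D -/D'.
  have -> : D * (sigma / D) = sigma by rewrite mulrC divfK // gt_eqF.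
  by move=> E; lra.
have defect : 0 <= D * (B xpredT - B phi) <= k%:R / D'.
  rewrite -sumrB; apply/andP; split.
    rewrite mulr_ge0 ?(ltW D0) // sumr_ge0 // => v _.
    by rewrite -mulrBr mulr_ge0 // subr_ge0 ler_nat leq_b1.
  rewrite mulrC -ler_pdivlMr //.
  have h' v : weight v = m.+3 -> ~~ phi (behead (nseq (2 + k) false ++ v)) = false.
    by move=> wv; apply: negbTE; rewrite negbK hphi.
  have := sum_ones_defect (psi := fun w => ~~ phi (behead w)) h'.
  rewrite addn0 -/n -/D -/D' mulrA; apply: le_trans.
  apply: ler_sum => v _ /=.
  by case: (phi _); rewrite /= ?mulr1 ?mulr0 ?subrr ?subr0.
have small : 0 <= expect_after_one (m + k).+3 (fun v => phi (false :: v)) <= sigma / D'.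
  rewrite expect_after_one_ge0 /= -expect_after_oneT.
  by apply: ler_sum => v _; rewrite ler_wpM2l // ler_nat leq_b1.
have sD : 0 <= sigma / D' by rewrite divr_ge0 // ltW.
have kD : 0 <= k%:R / D' by rewrite divr_ge0 // ltW.
rewrite split2 (_ : _ - _ = sigma / D' - D * (B xpredT - B phi)
   - expect_after_one (m + k).+3 (fun v => phi (false :: v))); last first.
  by rewrite mulrBr BT; ring.
rewrite [leRHS]mulrDl -[2 * _ / _]mulrA ler_norml.
by move: defect small => /andP[? ?] /andP[? ?]; apply/andP; split; lra.
Qed.

Lemma expect_after_hike_small n t phi : 0 < t -> n.-1%:R < t ->
  expect_after_hike n t phi = 0.
Proof.
move=> t0 nt; rewrite /expect_after_hike /expect big_seq_cond big1 // => w.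
rewrite andbT mem_YF => /eqP wn; rewrite leNgt (_ : _ < t = true) /= ?mulr0 //.
by apply: le_lt_trans nt; rewrite ler_nat -wn weight_after_hike.
Qed.

Lemma expect_after_hike_rec n t phi : expect_after_hike n.+3 t phi =
  ((t <= n.+2%:R)%R)%:R * expect_after_one n.+2 phi +
  n.+2%:R / (n.+2%:R + sigma) * expect_after_hike n.+1 t phi.
Proof.
rewrite /expect_after_hike expectSS; congr (_ + _); rewrite /expect_after_one mulr_sumr.
apply: big_YF_weight => v /= ->.
by case: (t <= _); rewrite /= ?mul1r // mulr0 mul0r.
Qed.

(** For phi and for [xpredT] the recursion of [expect_after_hike_rec] has the same nonnegative
    coefficients, and its source terms come from weights at least t only. The estimate at the
    closing 1 thus passes to whole hikes with the same constants; t > 2 makes the initial cases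
    vanish. *)
Lemma expect_after_hike_close (lam eps m0 t : R) phi :
  2 < t -> m0 <= t ->
  (forall n, m0 <= n%:R -> `|expect_after_one n phi - lam * expect_after_one n xpredT|
     <= eps * expect_after_one n xpredT) ->
  forall n, `|expect_after_hike n t phi - lam * expect_after_hike n t xpredT|
     <= eps * expect_after_hike n t xpredT.
Proof.
move=> t2 mt H; elim/ltn_ind => n IH.
have t0 : 0 < t by apply: lt_trans t2.
have [nt|tn] := ltP n.-1%:R t.
  by rewrite !expect_after_hike_small // !mulr0 subrr normr0.
case: n IH tn => [|[|[|n]]] IH /= tn;
  try by move: (lt_le_trans t2 tn); rewrite ?ltrn0 // ltr_nat.
rewrite !expect_after_hike_rec tn !mul1r.
set c := _ / _; set a := expect_after_one _ phi; set a1 := expect_after_one _ _.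
have c0 : 0 <= c by rewrite divr_ge0 // ltW.
rewrite (_ : _ - _ = (a - lam * a1) +
  c * (expect_after_hike n.+1 t phi - lam * expect_after_hike n.+1 t xpredT)); last ring.
rewrite (le_trans (ler_normD _ _)) // normrM (ger0_norm c0) mulrDr lerD //.
  exact: H (le_trans mt tn).
by rewrite mulrCA ler_wpM2l // IH.
Qed.

(** Passing to the complement makes the recursion homogeneous, so that it unfolds into a product. *)
Definition escape n (t : R) : R := 1 - expect_after_hike n t xpredT.

Lemma escape_small n (t : R) : 0 < t -> n.-1%:R < t -> escape n t = 1.
Proof. by move=> t0 nt; rewrite /escape expect_after_hike_small // subr0. Qed.

Lemma escape_rec n (t : R) : t <= n.+2%:R ->
  escape n.+3 t = n.+2%:R / (n.+2%:R + sigma) * escape n.+1 t.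
Proof.
move=> tn; rewrite /escape expect_after_hike_rec tn mul1r expect_after_oneT.
by move: n.+2%:R (Dneq0 n.+2) => K K0; field.
Qed.

Let one_powR : 1 = 1 `^ (sigma / 2) :> R. Proof. by rewrite powR1. Qed.
Let sigma2_ge0 : 0 <= sigma / 2. Proof. by rewrite divr_ge0 // ltW. Qed.

Lemma escape_case n (t : R) : 2 < t ->
  n.-1%:R < t \/ exists2 m, n = m.+3 & t <= m.+2%:R.
Proof.
move=> t2; have [|tn] := ltP n.-1%:R t; [by left|right].
case: n tn => [|[|[|n]]] /= tn; last by exists n.
all: by move: (lt_le_trans t2 tn); rewrite ltr_nat.
Qed.

(** With K = n - 1, [ratio_le_powR] bounds the factor K / (K + sigma) by a power of (K + sigma) / (K
    + sigma + 2), and these bases telescope as n drops by 2. The shift in the numerator makes the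
    base at least 1 where the recursion stops, at n - 1 < t. *)
Lemma escape_le n (t : R) : 2 < t ->
  escape n t <= ((t + sigma + 2) / (n%:R + sigma + 1)) `^ (sigma / 2).
Proof.
move=> t2; elim/ltn_ind: n => n IH.
have t0 : 0 < t by lra.
have [nt|[m nm tm]] := escape_case n t2.
  rewrite escape_small // [leLHS]one_powR; apply: powR_le_mono => //.
  rewrite ler_pdivlMr ?mul1r; last by have := Dgt0 n; lra.
  suff : n%:R <= n.-1%:R + 1 :> R by lra.
  by rewrite natr1 ler_nat; lia.
rewrite nm escape_rec //.
have m1 : m.+1%:R + 1 = m.+2%:R :> R by rewrite natr1.
have m2 : m.+2%:R + 1 = m.+3%:R :> R by rewrite natr1.
have c0 : 0 <= m.+2%:R / (m.+2%:R + sigma) by rewrite divr_ge0 // ltW.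
have mn : (m.+1 < n)%N by rewrite nm.
apply: (le_trans (ler_wpM2l c0 (IH _ mn))).
have Dm := Dgt0 m.+2.
rewrite (_ : m.+1%:R + sigma + 1 = m.+2%:R + sigma); last by rewrite -m1; ring.
rewrite (_ : m.+3%:R + sigma + 1 = m.+2%:R + sigma + 2); last by rewrite -m2; ring.
set K := m.+2%:R in Dm *.
have -> : (t + sigma + 2) / (K + sigma + 2) =
    (K + sigma) / (K + sigma + 2) * ((t + sigma + 2) / (K + sigma)).
  by field; rewrite !gt_eqF //; lra.
rewrite [leRHS]powRM ?divr_ge0 //; try lra.
  by rewrite ler_wpM2r ?powR_ge0 // ratio_le_powR.
by have := sigma_gt0; lra.
Qed.

(** Here the telescoping bases are (K - 2) / K; the condition t <= n + 1, preserved by the descent,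
    keeps the final base at most 1. *)
Lemma escape_ge n (t : R) : 4 < t -> t <= n%:R + 1 ->
  ((t - 2) / (n%:R - 1)) `^ (sigma / 2) <= escape n t.
Proof.
move=> t4; elim/ltn_ind: n => n IH tn1.
have t0 : 0 < t by lra.
have t2 : 2 < t by lra.
have [nt|[m nm tm]] := escape_case n t2.
  rewrite escape_small // [leRHS]one_powR; apply: powR_le_mono => //.
    by rewrite divr_ge0 //; lra.
  by rewrite ler_pdivrMr ?mul1r; lra.
rewrite nm escape_rec //.
have m1 : m%:R + 1 = m.+1%:R :> R by rewrite natr1.
have m2 : m.+1%:R + 1 = m.+2%:R :> R by rewrite natr1.
have m3 : m.+2%:R + 1 = m.+3%:R :> R by rewrite natr1.
have c0 : 0 <= m.+2%:R / (m.+2%:R + sigma) by rewrite divr_ge0 // ltW.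
have mn : (m.+1 < n)%N by rewrite nm.
have tm1 : t <= m.+1%:R + 1 by lra.
apply: (le_trans _ (ler_wpM2l c0 (IH _ mn tm1))).
rewrite (_ : m.+3%:R - 1 = m.+2%:R); last by rewrite -m3 addrK.
rewrite (_ : m.+1%:R - 1 = m.+2%:R - 2); last by lra.
set K := m.+2%:R in tm m2 m3 *.
have -> : (t - 2) / K = (K - 2) / K * ((t - 2) / (K - 2)).
  by field; rewrite !gt_eqF //; lra.
rewrite [leLHS]powRM ?divr_ge0 //; try lra.
by rewrite ler_wpM2r ?powR_ge0 // ratio_ge_powR ?(ltW sigma_gt0) //; lra.
Qed.

Lemma escape_fixed_cvg0 (t e : R) : 2 < t -> 0 < e ->
  \forall n \near \oo, escape n t <= e.
Proof.
move=> t2 e0; near=> n.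
apply: (le_trans (escape_le n t2)).
have p0 : sigma / 2 != 0 by rewrite gt_eqF // divr_gt0.
(* e is rewritten as the power sigma / 2 of e^(2 / sigma), so that bases can be compared. *)
rewrite -[leRHS]powRr1 ?(ltW e0) // -[X in e `^ X](mulVf p0) [leRHS]powRrM.
have Dn := Dgt0 n; have s0 := sigma_gt0; apply: powR_le_mono => //; first by rewrite divr_ge0 //; lra.
near: n.
have e'0 : 0 < e `^ (sigma / 2)^-1 by rewrite powR_gt0.
have := cvg_div_natD (t + sigma + 2) (sigma + 1) => /cvgr0Pnorm_le/(_ _ e'0).
by apply: filterS => n /ler_normlW; rewrite (addrA n%:R).
Unshelve. all: by end_near. Qed.

Lemma escape_cvg a : 0 < a < 1 ->
  escape n ((1 - a) * n%:R) @[n --> \oo] --> (1 - a) `^ (sigma / 2).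
Proof.
move=> /andP[a0 a1]; have b0 : 0 < 1 - a by lra.
apply: (@squeeze_cvgr _ _ _ _
  (fun n => (((1 - a) * n%:R - 2) / (n%:R - 1)) `^ (sigma / 2))
  (fun n => (((1 - a) * n%:R + (sigma + 2)) / (n%:R + (sigma + 1))) `^ (sigma / 2))).
- near=> n.
  have t4 : 4 < (1 - a) * n%:R.
    rewrite mulrC -ltr_pdivrMr // (@lt_le_trans _ _ (4 / (1 - a) + 1)) ?ltrDl //.
    by near: n; exact: nbhs_infty_ger.
  apply/andP; split.
    apply: escape_ge => //.
    by have : 0 <= a * n%:R; [rewrite mulr_ge0 // ltW|lra].
  have t2 : 2 < (1 - a) * n%:R by lra.
  rewrite (addrA _ sigma) (addrA n%:R); exact: escape_le.
- by apply: cvg_powR => //; exact: cvg_linear_div.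
- by apply: cvg_powR => //; exact: cvg_linear_div.
Unshelve. all: by end_near. Qed.

Lemma expect_after_hike_cvg_cdf a : 0 < a <= 1 ->
  expect_after_hike n ((1 - a) * n%:R) xpredT @[n --> \oo] --> Gcdf sigma a.
Proof.
move=> /andP[a0]; rewrite le_eqVlt => /orP[/eqP ->|a1].
  (* At a = 1 the threshold is 0, outside the range of [escape_cvg]; every word meets it. *)
  rewrite /Gcdf subrr powR0 ?subr0; last by rewrite gt_eqF // divr_gt0.
  apply: (@cvg_trans _ (1 @[n --> \oo])); last exact: cvg_cst.
  apply: near_eq_cvg; apply: nearW => n.
  by rewrite /expect_after_hike expectT // => w _; rewrite mul0r ler0n.
rewrite (_ : (fun n => _) = (fun n => 1 - escape n ((1 - a) * n%:R))); last first.
  by apply/funext => n; rewrite /escape subKr.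
by apply: cvgB; [exact: cvg_cst|apply: escape_cvg; rewrite a0].
Qed.

(** This is [expect_after_one_approx] divided by sigma. The error is stated relative to the mass at
    [xpredT], of order 1 / n, as [expect_after_hike_close] requires in order to add up over all hike
    lengths. *)
Lemma expect_after_one_cvg phi (lam : R) m1 k :
  (forall m v, (m1 <= m)%N -> weight v = m.+3 -> phi (nseq k.+1 false ++ v)) ->
  expect n phi @[n --> \oo] --> lam ->
  forall e, 0 < e -> \forall n \near \oo,
    `|expect_after_one n phi
      - (lam / sigma + (1 - sigma^-1)) * expect_after_one n xpredT|
    <= e * expect_after_one n xpredT.
Proof.
move=> hphi phil e e0.
have es : 0 < e * sigma / 2 by rewrite !divr_gt0 // mulr_gt0.
move/cvgrPdist_le/(_ _ es) : phil => phil.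
have /cvgr0Pnorm_le/(_ _ es) err := cvg_div_natD (k%:R + 2 * sigma) (sigma - 1).
near=> n.
have nmk : (m1 + k.+4 <= n)%N by near: n; exact: nbhs_infty_ge.
have -> : n = (n - k - 4 + k).+4 by lia.
set m := (n - k - 4)%N; have mm1 : (m1 <= m)%N by rewrite /m; lia.
have nE : n = (m + k).+4 by rewrite /m; lia.
have := expect_after_one_approx (hphi m ^~ mm1).
have : `|lam - expect n phi| <= e * sigma / 2.
  by near: n.
have : `|(k%:R + 2 * sigma) / (n%:R + (sigma - 1))| <= e * sigma / 2.
  by near: n.
rewrite nE expect_after_oneT.
rewrite (_ : (m + k).+4%:R + (sigma - 1) = (m + k).+3%:R + sigma); last first.
  by rewrite -natr1; ring.
set D := (m + k).+4%:R + sigma; set a := expect_after_one _ _; set E := expect _ _.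
have D0 : 0 < D by exact: Dgt0.
move=> /ler_normlP[_ h1] h2 h3.
have sn0 : sigma != 0 by rewrite gt_eqF.
rewrite -(@ler_pM2l _ D) // -{1}(gtr0_norm D0) -normrM.
rewrite (_ : D * (a - _) = (D * a - (E + (sigma - 1))) - (lam - E)); last first.
  by field; rewrite sn0 gt_eqF.
rewrite (_ : D * (e * _) = e * sigma / 2 + e * sigma / 2); last first.
  by field; rewrite gt_eqF.
by rewrite (le_trans (ler_normB _ _)) // lerD // (le_trans h3).
Unshelve. all: by end_near. Qed.

(** The threshold [t n] may lie below the weights where the hypothesis is effective (it is 0 at
    level 1). It is then raised to a fixed t0, at a cost bounded by [escape n t0], which tends to
    0. *)
Lemma expect_after_hike_cvg phi (lam : R) (t : nat -> R) :
  (forall e, 0 < e -> \forall n \near \oo,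
    `|expect_after_one n phi - lam * expect_after_one n xpredT|
    <= e * expect_after_one n xpredT) ->
  expect_after_hike n (t n) phi - lam * expect_after_hike n (t n) xpredT
    @[n --> \oo] --> 0.
Proof.
move=> H; apply/cvgr0Pnorm_le => e e0.
have e2 : 0 < e / 2 by rewrite divr_gt0.
have [m0 _ Hm0] := H _ e2.
pose t0 : R := m0%:R + 3.
have t02 : 2 < t0 by rewrite /t0; have : 0 <= m0%:R :> R by []; lra.
have lam1 : 0 < 1 + `|lam| by rewrite ltr_pwDl.
have e3 : 0 < e / 2 / (1 + `|lam|) by rewrite divr_gt0.
near=> n.
have esc : escape n t0 <= e / 2 / (1 + `|lam|).
  by near: n; exact: escape_fixed_cvg0.
have close u : t0 <= u -> `|expect_after_hike n u phi - lam * expect_after_hike n u xpredT|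
    <= e / 2.
  move=> tu; apply: (@le_trans _ _ (e / 2 * expect_after_hike n u xpredT)).
    apply: (@expect_after_hike_close lam (e / 2) t0) => //; first exact: lt_le_trans tu.
    move=> j t0j; apply: Hm0 => /=.
    by rewrite -(@ler_nat R) (le_trans _ t0j) // /t0 lerDl.
  by rewrite ler_piMr ?expect_le1 // ltW.
have [tn|tn] := leP t0 (t n); first by rewrite (le_trans (close _ tn)) //; lra.
have bound psi : 0 <= expect_after_hike n (t n) psi - expect_after_hike n t0 psi
    <= escape n t0.
  apply/andP; split.
    rewrite subr_ge0; apply: expect_le => w _ /andP[h ->]; rewrite andbT.
    by rewrite (le_trans _ h) // ltW.
  rewrite /escape lerBlDr addrC addrA lerBrDl.
  rewrite -(expectT (n := n) (phi := xpredT)) // /expect_after_hike /expect.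
  rewrite -!big_split; apply: ler_sum => w _ /=; rewrite -!mulrDr ler_wpM2l // -!natrD ler_nat.
  by do 2![case: (_ <= _)%R] => /=; case: (psi _).
have b1 := bound phi; have b2 := bound xpredT.
set F := expect_after_hike n (t n) phi in b1 *.
set F1 := expect_after_hike n (t n) xpredT in b2 *.
have := close t0 (lexx _).
set G := expect_after_hike n t0 phi in b1 *.
set G1 := expect_after_hike n t0 xpredT in b2 * => cl.
rewrite (_ : F - lam * F1 = (G - lam * G1) + ((F - G) - lam * (F1 - G1))); last ring.
rewrite (le_trans (ler_normD _ _)) // [leRHS]splitr lerD //.
rewrite (le_trans (ler_normB _ _)) // normrM.
have -> : `|F - G| = F - G by rewrite ger0_norm // (andP b1).1.
have -> : `|F1 - G1| = F1 - G1 by rewrite ger0_norm // (andP b2).1.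
apply: (@le_trans _ _ ((1 + `|lam|) * escape n t0)).
  by rewrite mulrDl mul1r lerD ?(andP b1).2 // ler_wpM2l ?(andP b2).2.
by rewrite mulrC -ler_pdivlMr.
Unshelve. all: by end_near. Qed.

(** The limit law read hike by hike: after a value, the sequence restarts with probability 1 / sigma
    or is 0 for ever, and 0 meets every level. [xi_cdfE] identifies it with the closed form. *)
Fixpoint limit_cdf (s : seq R) : R :=
  if s is a :: s' then Gcdf sigma a * (limit_cdf s' / sigma + (1 - sigma^-1))
  else 1.

Lemma hikes_le_cvg (s : seq R) : (forall a, a \in s -> 0 < a <= 1) ->
  expect n (hikes_le s) @[n --> \oo] --> limit_cdf s.
Proof.
elim: s => [|a s IH] h /=.
  apply: (@cvg_trans _ (1 @[n --> \oo])); last exact: cvg_cst.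
  by apply: near_eq_cvg; apply: nearW => n; rewrite expectT.
have hs b : b \in s -> 0 < b <= 1 by move=> bs; apply: h; rewrite inE bs orbT.
set lam := limit_cdf s / sigma + _.
(* Since the levels are positive, the ratios 1 / W of a run of 1s are below all of them once W >=
   m1. *)
have [m1 hm1] : exists m1, forall b, b \in s -> 1 <= b * m1%:R.
  elim: s hs {IH h lam} => [|b s IH] hs; first by exists 0%N.
  have [|m1 hm1] := IH; first by move=> c cs; apply: hs; rewrite inE cs orbT.
  have /andP[b0 _] := hs b (mem_head _ _).
  exists (maxn m1 (Num.truncn b^-1).+1) => c; rewrite inE => /orP[/eqP ->|cs].
    rewrite mulrC -ler_pdivrMr // mul1r.
    apply: (@le_trans _ _ (Num.truncn b^-1).+1%:R); first exact/ltW/truncnS_gt.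
    by rewrite ler_nat leq_maxr.
  apply: (le_trans (hm1 c cs)); rewrite ler_wpM2l ?ler_nat ?leq_maxl //.
  have /andP[/ltW //] : 0 < c <= 1 by apply: hs; rewrite inE cs orbT.
have phi1 m v : (m1 <= m)%N -> weight v = m.+3 ->
    hikes_le s (nseq (size s).+1 false ++ v).
  move=> m1m wv; rewrite -addn1 nseqD -catA.
  apply: (hikes_le_ones hm1); rewrite /= weight_cons wv; lia.
have C1 := expect_after_hike_cvg (fun n => (1 - a) * n%:R)
  (expect_after_one_cvg phi1 (IH hs)).
have C2 : lam * expect_after_hike n ((1 - a) * n%:R) xpredT @[n --> \oo]
    --> lam * Gcdf sigma a.
  apply: cvgM; first exact: cvg_cst.
  exact: expect_after_hike_cvg_cdf (h a (mem_head _ _)).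
have /(_ _) C3 := cvgD C1 C2; rewrite add0r [lam * Gcdf _ _]mulrC in C3.
apply: (cvg_trans _ C3); apply: near_eq_cvg.
apply: nearW => n; rewrite fctE subrK.
by apply: eq_expect => w ->.
Qed.

End WordSums.

(** * Independent uniform variables from binary digits *)

Section MeasurableRays.
Context d (T : measurableType d) (R : realType).

Lemma measurable_le (X : T -> R) (a : R) : measurable_fun setT X ->
  measurable [set u | X u <= a].
Proof.
move=> mX; rewrite (_ : mkset _ = X @^-1` `]-oo, a]); last first.
  by apply/seteqP; split => u /=; rewrite in_itv.
by rewrite -[X in measurable X]setTI; apply: mX => //; exact: measurable_itv.
Qed.

Lemma measurable_forall_le (X : nat -> T -> R) n (alpha : nat -> R) :
  (forall i, measurable_fun setT (X i)) ->
  measurable [set u | forall i, (i < n)%N -> X i u <= alpha i].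
Proof.
move=> mX; elim: n => [|n IH].
  by rewrite (_ : mkset _ = setT) //; apply/seteqP; split => // u _.
rewrite (_ : mkset _ = [set u | forall i, (i < n)%N -> X i u <= alpha i] `&`
    [set u | X n u <= alpha n]); last first.
  apply/seteqP; split => u /= h.
    by split=> [i it|]; apply: h => //; exact: ltnW.
  by move=> i; rewrite ltnS leq_eqVlt => /orP[/eqP ->|it]; [exact: h.2|exact: h.1].
by apply: measurableI => //; exact: measurable_le.
Qed.

End MeasurableRays.

Section UniformBits.
Variable R : realType.
Local Notation T := (measurableTypeR R).
Implicit Types (A B : set T) (a c : R).

Definition unif : probability T R := uniform_prob (@ltr01 R).

Definition pr (A : set T) : R := fine (unif A).

Lemma prE A : measurable A -> unif A = (pr A)%:E.
Proof. by move=> mA; rewrite fineK // fin_num_measure. Qed.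

Lemma pr_ge0 A : 0 <= pr A.
Proof. by rewrite fine_ge0. Qed.

Lemma pr0 : pr set0 = 0.
Proof. by rewrite /pr measure0. Qed.

Lemma prT : pr setT = 1.
Proof. by rewrite /pr probability_setT. Qed.

Lemma pr_le1 A : measurable A -> pr A <= 1.
Proof. by move=> mA; rewrite -lee_fin -prE // probability_le1. Qed.

Lemma prU A B : measurable A -> measurable B -> [disjoint A & B]%classic ->
  pr (A `|` B) = pr A + pr B.
Proof.
move=> mA mB AB; apply: EFin_inj; rewrite EFinD -!prE //; last exact: measurableU.
by rewrite measureU //; exact/disj_set2P.
Qed.

Lemma unif_lebesgue A : measurable A -> unif A = lebesgue_measure (A `&` `[0, 1]).
Proof.
move=> mA; rewrite /unif /= /uniform_prob integral_uniform_pdf.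
rewrite (eq_integral (cst 1%E)); last first.
  move=> u; rewrite inE /= => -[_]; rewrite in_itv /= => u01.
  by rewrite /uniform_pdf u01 subr0 invr1.
by rewrite integral_cst ?mul1e //; exact: measurableI.
Qed.

Lemma pr_restrict A B : measurable A -> measurable B ->
  (forall u, 0 <= u <= 1 -> A u <-> B u) -> pr A = pr B.
Proof.
move=> mA mB AB; rewrite /pr !unif_lebesgue //; congr (fine (_ _)).
by apply/seteqP; split => u [h]; rewrite /= in_itv /= => u01; split=> //; apply/AB.
Qed.

Lemma pr_itv bl br a c : 0 <= a -> a <= c -> c <= 1 ->
  pr [set` Interval (BSide bl a) (BSide br c)] = c - a.
Proof.
move=> a0 ac c1; rewrite /pr unif_lebesgue; last exact: measurable_itv.
rewrite setIidl; last first.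
  move=> u; rewrite /= !itv_boundlr /= !bnd_simp => /andP[h1 h2].
  by apply/andP; split; move: bl br h1 h2 => [] [] /=; rewrite ?bnd_simp => *; lra.
rewrite lebesgue_measure_itv /= lte_fin; case: ltP => // ca.
by rewrite (le_anti (introT andP (conj ac ca))) subrr.
Qed.

(** The distribution function of the uniform law on [0, 1]. *)
Definition clamp (a : R) : R := Num.min 1 (Num.max 0 a).

Lemma clamp_lt0 a : a <= 0 -> clamp a = 0.
Proof. by move=> a0; rewrite /clamp max_l // min_r. Qed.

Lemma clamp_ge1 a : 1 <= a -> clamp a = 1.
Proof. by move=> a1; rewrite /clamp max_r ?min_l //; apply: le_trans a1. Qed.

Lemma clamp_id a : 0 <= a -> a <= 1 -> clamp a = a.
Proof. by move=> a0 a1; rewrite /clamp max_r // min_r. Qed.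

Lemma clamp_itv a : 0 <= clamp a <= 1.
Proof.
have [/ltW a0|a0] := ltP a 0; first by rewrite clamp_lt0 // lexx ler01.
have [a1|/ltW a1] := leP a 1; first by rewrite clamp_id // a0.
by rewrite clamp_ge1 // ler01 lexx.
Qed.

Lemma clamp_double a : clamp a = (clamp (2 * a) + clamp (2 * a - 1)) / 2.
Proof.
have [a0|a0] := leP a 0; first by rewrite !clamp_lt0; lra.
have [a1|a1] := leP 1 a; first by rewrite !clamp_ge1; lra.
rewrite (clamp_id (ltW a0) (ltW a1)).
have [a2|a2] := leP (2 * a) 1.
  by rewrite (@clamp_lt0 (_ - 1)) ?clamp_id; lra.
by rewrite (@clamp_ge1 (2 * a)) ?clamp_id; lra.
Qed.

Lemma pr_ray a : pr [set u | u <= a] = clamp a.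
Proof.
have mS : measurable [set u : T | u <= a] by apply: (@measurable_le _ T R id).
have [a0|a0] := ltP a 0.
  rewrite clamp_lt0 ?(ltW a0) // -pr0; apply: (pr_restrict mS measurable0) => u /andP[u0 _].
  by split=> //= ua; move: (lt_le_trans a0 u0); rewrite ltNge ua.
have [a1|a1] := leP 1 a.
  rewrite clamp_ge1 // -prT; apply: (pr_restrict mS measurableT) => u /andP[_ u1]; split=> //= _.
  exact: le_trans a1.
rewrite clamp_id ?(ltW a1) // -[RHS]subr0 -(@pr_itv true false) ?(ltW a1) //.
apply: (pr_restrict mS (measurable_itv _)).
by move=> u /andP[u0 u1] /=; rewrite in_itv /= u0.
Qed.

(* A finite measure on the line is determined by its values on the rays. *)
Lemma pr_of_rays (E : set T) (X : T -> R) (k : R) :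
  measurable E -> measurable_fun setT X -> 0 <= k -> pr E = k ->
  (forall a, pr (E `&` [set u | X u <= a]) = k * clamp a) ->
  forall B, measurable B -> pr (E `&` X @^-1` B) = k * pr B.
Proof.
move=> mE mX k0 EK H B mB.
have mXB (C : set T) : measurable C -> measurable (X @^-1` C).
  by move=> mC; rewrite -[Z in measurable Z]setTI; exact: mX.
have mEX (C : set T) : measurable C -> measurable (E `&` X @^-1` C).
  by move=> mC; apply: measurableI => //; exact: mXB.
pose m1 : {measure set T -> \bar R} :=
  @measure_function_pushforward__canonical__measure_function_Measure _ _ T T R
    (mrestr unif mE) X mX.
pose m2 : {measure set T -> \bar R} := mscale (NngNum k0) unif.
have m1E C : measurable C -> m1 C = (pr (E `&` X @^-1` C))%:E.
  by move=> mC; rewrite /m1 /= /pushforward /mrestr setIC prE //; exact: mEX.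
have m2E C : measurable C -> m2 C = (k * pr C)%:E.
  by move=> mC; rewrite /m2 /= /mscale /= prE.
suff : m1 B = m2 B by rewrite m1E // m2E // => -[].
apply: (@measure_unique _ R T (@RGenOInfty.G R) (fun n => `]- n%:R, +oo[%classic)) => //.
- exact: RGenOInfty.measurableE.
- move=> _ _ [a ->] [c ->]; exists (Num.max a c).
  by apply/seteqP; split => u /=; rewrite !in_itv /= !andbT gt_max; [move=> [-> ->]|move/andP].
- by move=> n; exists (- n%:R).
- apply/seteqP; split => // u _; exists (Num.truncn `|u|).+1 => //=.
  rewrite in_itv /= andbT.
  have := truncnS_gt `|u|; have := ler_norm (- u); rewrite normrN; lra.
- move=> _ [a ->]; have mr : measurable `]a, +oo[%classic by exact: measurable_itv.
  have mle : measurable (`]-oo, a]%classic : set T) by exact: measurable_itv.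
  rewrite m1E // m2E //; congr EFin.
  have disj : [disjoint `]-oo, a]%classic & (`]a, +oo[%classic : set T)]%classic.
    apply/disj_set2P/seteqP; split => // u /= []; rewrite !in_itv /= andbT => h1 h2.
    by move: (lt_le_trans h2 h1); rewrite ltxx.
  have UT : `]-oo, a]%classic `|` `]a, +oo[%classic = [set: T].
    apply/seteqP; split => // u _ /=; rewrite !in_itv /= andbT.
    by have [|] := leP u a; [left|right].
  have p1 : pr (`]-oo, a]%classic) + pr (`]a, +oo[%classic) = 1 by rewrite -prU // UT prT.
  have p2 : pr (E `&` X @^-1` `]-oo, a]) + pr (E `&` X @^-1` `]a, +oo[) = k.
    rewrite -prU; [|exact: mEX|exact: mEX|].
      by rewrite -setIUr -preimage_setU UT preimage_setT setIT.
    by apply/disj_set2P; rewrite setIACA -preimage_setI (disj_set2P disj) preimage_set0 setI0.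
  have rayE : (`]-oo, a]%classic : set T) = [set u | u <= a].
    by apply/seteqP; split => u /=; rewrite in_itv.
  have p3 : pr (E `&` X @^-1` `]-oo, a]) = k * clamp a.
    by rewrite -H; congr (pr (_ `&` _)); apply/seteqP; split => u /=; rewrite in_itv.
  move: p1 p2; rewrite p3 rayE pr_ray => p1 p2.
  by apply: (addrI (k * clamp a)); rewrite p2 -mulrDr p1 mulr1.
- by move=> n; rewrite m1E ?ltry //; exact: measurable_itv.
Qed.

Definition high (u : T) : bool := (2^-1 <= u :> R).

(** The shift of binary digits. It fixes 1, read as 0.111..., and so preserves [0, 1]. *)
Definition dbl (u : T) : T := 2 * (u : R) - (high u)%:R.

Lemma measurable_high (c : bool) : measurable [set u | high u = c].
Proof.
have mh : measurable_fun setT high.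
  by apply: measurable_fun_ler => //; exact: measurable_cst.
have := mh measurableT [set c] => /(_ _); rewrite setTI; exact.
Qed.

Lemma measurable_dbl : measurable_fun setT dbl.
Proof.
rewrite /dbl; apply: measurable_funB; first exact: measurable_funM.
rewrite (_ : (fun u => _) = (fun u => if high u then 1 else 0)); last first.
  by apply/funext => u; case: (high u).
apply: measurable_fun_ifT => //.
by apply: measurable_fun_ler => //; exact: measurable_cst.
Qed.

Lemma pr_high_dbl_ray (c : bool) (a : R) :
  pr ([set u | high u = c] `&` [set u | (dbl u : R) <= a]) = 2^-1 * clamp a.
Proof.
have mS : measurable ([set u | high u = c] `&` [set u | (dbl u : R) <= a]).
  by apply: measurableI; [exact: measurable_high|exact: measurable_le measurable_dbl].
have [a0|a0] := ltP a 0.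
  rewrite clamp_lt0 ?(ltW a0) // mulr0 -pr0.
  apply: (pr_restrict mS measurable0) => u /andP[u0 u1]; split=> //= -[].
  by rewrite /dbl /high => _; case: (leP 2^-1 u) => /= h; lra.
case: c mS => mS; have [a1|a1] := leP 1 a.
- rewrite clamp_ge1 // (_ : 2^-1 * 1 = 1 - 2^-1 :> R); last by field.
  rewrite -(@pr_itv true false) ?invf_le1 ?ler1n //.
  apply: (pr_restrict mS (measurable_itv _)) => u /andP[u0 u1] /=.
  rewrite in_itv /= u1 andbT /dbl /high; split=> [[]//|h]; rewrite h; split=> //=; lra.
- rewrite clamp_id ?(ltW a1) // (_ : 2^-1 * a = (1 + a) / 2 - 2^-1); last by field.
  rewrite -(@pr_itv true false); [|lra..].
  apply: (pr_restrict mS (measurable_itv _)) => u /andP[u0 u1] /=.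
  rewrite in_itv /= /dbl /high; split=> [[h]|/andP[h1 h2]].
    by rewrite h /= => h2; lra.
  by rewrite h1 /=; split=> //; lra.
- rewrite clamp_ge1 // (_ : 2^-1 * 1 = 2^-1 - 0 :> R); last by field.
  rewrite -(@pr_itv true true) ?invf_le1 ?ler1n //.
  apply: (pr_restrict mS (measurable_itv _)) => u /andP[u0 u1] /=.
  rewrite in_itv /= /dbl /high; split=> [[/negbT]|/andP[_ h]].
    by rewrite -ltNge => h _; rewrite u0.
  by rewrite leNgt h /=; split=> //; lra.
- rewrite clamp_id ?(ltW a1) // (_ : 2^-1 * a = a / 2 - 0); last by field.
  rewrite -(@pr_itv true false); [|lra..].
  apply: (pr_restrict mS (measurable_itv _)) => u /andP[u0 u1] /=.
  rewrite in_itv /= /dbl /high u0 /=; split=> [[h]|h]; first by rewrite h /=; lra.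
  by rewrite leNgt (_ : u < 2^-1) /=; [split=> //; lra|lra].
Qed.

(** [dbl] maps each half of [0, 1] affinely onto [0, 1] up to endpoints; this is checked on rays and
    extended by [pr_of_rays]. *)
Lemma pr_high_dbl (c : bool) B : measurable B ->
  pr ([set u | high u = c] `&` dbl @^-1` B) = 2^-1 * pr B.
Proof.
apply: (pr_of_rays (measurable_high c) measurable_dbl); first by rewrite invr_ge0.
  have := pr_high_dbl_ray c 1; rewrite clamp_ge1 // mulr1 => <-.
  apply: pr_restrict.
  - exact: measurable_high.
  - by apply: measurableI; [exact: measurable_high|exact: measurable_le measurable_dbl].
  - move=> u /andP[u0 u1]; split=> [h|[]//]; split=> //=.
    by rewrite /dbl /high; case: (leP 2^-1 u) => /= h'; lra.
exact: pr_high_dbl_ray.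
Qed.

Lemma measurable_preimage (X : T -> T) B :
  measurable_fun setT X -> measurable B -> measurable (X @^-1` B).
Proof. by move=> mX mB; rewrite -[Z in measurable Z]setTI; exact: mX. Qed.

Lemma pr_dbl_cases A B0 B1 : measurable A -> measurable B0 -> measurable B1 ->
  (forall u, A u <-> if high u then B1 (dbl u) else B0 (dbl u)) ->
  pr A = (pr B0 + pr B1) / 2.
Proof.
move=> mA m0 m1 AE.
have mC (c : bool) B : measurable B -> measurable ([set u | high u = c] `&` dbl @^-1` B).
  move=> mB; apply: measurableI; first exact: measurable_high.
  exact: (measurable_preimage measurable_dbl).
have -> : A = ([set u | high u = false] `&` dbl @^-1` B0) `|`
              ([set u | high u = true] `&` dbl @^-1` B1).
  apply/seteqP; split => u /=.
    by move=> /AE; case: (high u); [right|left].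
  by rewrite AE => -[[->]|[->]].
rewrite prU; [|exact: mC|exact: mC|].
  by rewrite !pr_high_dbl // -mulrDr mulrC.
by apply/disj_set2P/seteqP; split => // u /= [[-> _] []].
Qed.

Lemma pr_dbl B : measurable B -> pr (dbl @^-1` B) = pr B.
Proof.
move=> mB; rewrite (pr_dbl_cases (B0 := B) (B1 := B)) //; first by field.
- exact: (measurable_preimage measurable_dbl).
- by move=> u; case: (high u).
Qed.

(* evenbits u reads the binary digits of u at positions 0, 2, 4, ...; those at
   the remaining positions are read by evenbits (dbl u). *)
Fixpoint evenbits_approx (n : nat) (u : T) : R :=
  if n is m.+1 then ((high u)%:R + evenbits_approx m (dbl (dbl u))) / 2 else 0.

Lemma evenbits_approx_itv n u : 0 <= evenbits_approx n u <= 1.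
Proof.
elim: n u => [|n IH] u /=; first by rewrite lexx ler01.
by have := IH (dbl (dbl u)); case: (high u) => /=; lra.
Qed.

Lemma evenbits_approx_ndecr u : nondecreasing_seq (evenbits_approx ^~ u).
Proof.
apply/nondecreasing_seqP => n; elim: n u => [|n IH] u.
  exact: (andP (evenbits_approx_itv 1 u)).1.
by rewrite /= ler_pM2r ?invr_gt0 // lerD2l; exact: IH.
Qed.

Lemma measurable_high_natr : measurable_fun setT (fun u => (high u)%:R : R).
Proof.
rewrite (_ : (fun u => _) = (fun u => if high u then 1 else 0)); last first.
  by apply/funext => u; case: (high u).
apply: measurable_fun_ifT => //.
by apply: measurable_fun_ler => //; exact: measurable_cst.
Qed.

Lemma measurable_evenbits_approx n : measurable_fun setT (evenbits_approx n).
Proof.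
elim: n => [|n IH] /=; first exact: measurable_cst.
apply: measurable_funM; last exact: measurable_cst.
apply: measurable_funD; first exact: measurable_high_natr.
apply: (measurableT_comp IH); apply: (measurableT_comp measurable_dbl).
exact: measurable_dbl.
Qed.

Definition evenbits (u : T) : T := limn (evenbits_approx ^~ u).

Lemma evenbits_cvg u : evenbits_approx n u @[n --> \oo] --> (evenbits u : R).
Proof.
apply: nondecreasing_is_cvgn; first exact: evenbits_approx_ndecr.
by exists 1 => _ [n _ <-]; exact: (andP (evenbits_approx_itv n u)).2.
Qed.

Lemma evenbitsE u :
  evenbits u = ((high u)%:R + (evenbits (dbl (dbl u)) : R)) / 2 :> R.
Proof.
have h1 : evenbits_approx n.+1 u @[n --> \oo] --> (evenbits u : R).
  by have := @evenbits_cvg u; rewrite -(cvg_shiftS (evenbits_approx ^~ u)).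
apply: (cvg_unique _ h1) => //.
apply: cvgM; last exact: cvg_cst.
by apply: cvgD; [exact: cvg_cst|exact: evenbits_cvg].
Qed.

Lemma evenbits_itv u : 0 <= (evenbits u : R) <= 1.
Proof.
have c := @evenbits_cvg u; apply/andP; split.
  by apply: (cvgr_to_ge c); apply: nearW => n; exact: (andP (evenbits_approx_itv n u)).1.
by apply: (cvgr_to_le c); apply: nearW => n; exact: (andP (evenbits_approx_itv n u)).2.
Qed.

Lemma measurable_evenbits : measurable_fun setT evenbits.
Proof.
apply: (measurable_fun_cvg measurable_evenbits_approx) => u _.
exact: evenbits_cvg.
Qed.

Definition oddbits (u : T) : T := evenbits (dbl u).

Lemma measurable_oddbits : measurable_fun setT oddbits.
Proof. exact: (measurableT_comp measurable_evenbits measurable_dbl). Qed.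

Lemma eq_of_half_powers (z w : R) : (forall n, `|z - w| <= 2^-1 ^+ n) -> z = w.
Proof.
move=> h; apply/eqP; rewrite -subr_eq0 -normr_le0.
have c : (2^-1 : R) ^+ n @[n --> \oo] --> (0 : R).
  by apply: cvg_expr; rewrite ger0_norm ?invr_ge0 // invf_lt1 ?ltr1n.
by apply: (cvgr_to_ge c); apply: nearW => n; exact: h.
Qed.

Local Notation evenle a := [set u | (evenbits u : R) <= a].
Local Notation oddle a := [set u | (oddbits u : R) <= a].

Lemma measurable_evenle a : measurable (evenle a).
Proof. exact: measurable_le measurable_evenbits. Qed.

Lemma measurable_oddle a : measurable (oddle a).
Proof. exact: measurable_le measurable_oddbits. Qed.

(** One digit is used up, and seen from [dbl u] the remaining even positions are odd: the two kinds
    of rays are exchanged. *)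
Lemma evenleE a u : evenle a u <->
  if high u then oddle (2 * a - 1) (dbl u) else oddle (2 * a) (dbl u).
Proof.
rewrite /= evenbitsE /oddbits; case: (high u); split => /=; lra.
Qed.

Lemma pr_oddle a : pr (oddle a) = pr (evenle a).
Proof. by rewrite -(pr_dbl (measurable_evenle a)). Qed.

Lemma evenle_lt0 a : a < 0 -> evenle a = set0.
Proof.
move=> a0; apply/seteqP; split => // u /= h.
by have := evenbits_itv u; lra.
Qed.

Lemma evenle_ge1 a : 1 <= a -> evenle a = setT.
Proof.
move=> a1; apply/seteqP; split => // u _ /=.
by have := evenbits_itv u; lra.
Qed.

Lemma oddle_lt0 a : a < 0 -> oddle a = set0.
Proof.
move=> a0; apply/seteqP; split => // u /= h.
by have := evenbits_itv (dbl u); rewrite -/(oddbits u); lra.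
Qed.

Lemma oddle_ge1 a : 1 <= a -> oddle a = setT.
Proof.
move=> a1; apply/seteqP; split => // u _ /=.
by have := evenbits_itv (dbl u); rewrite -/(oddbits u); lra.
Qed.

(* Both sides satisfy the same functional equation, and one of the two terms on
   its right is always known: the difference halves at each application. *)
Lemma pr_evenle a : pr (evenle a) = clamp a.
Proof.
apply: eq_of_half_powers => n; elim: n a => [|n IH] a.
  have := clamp_itv a; have := pr_ge0 (evenle a).
  have := pr_le1 (measurable_evenle a).
  by rewrite expr0 ler_norml; lra.
have := pr_dbl_cases (measurable_evenle a) (measurable_oddle _) (measurable_oddle _) (evenleE a).
rewrite !pr_oddle => ->; rewrite clamp_double exprS.
have [a2|a2] := ltP (2 * a - 1) 0.
  rewrite (@evenle_lt0 (_ - 1)) // pr0 (@clamp_lt0 (_ - 1)) ?(ltW a2) // !addr0.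
  by rewrite -mulrBl normrM mulrC (ger0_norm (x := 2^-1)) ?invr_ge0 // ler_wpM2l ?invr_ge0.
rewrite (@evenle_ge1 (2 * a)) ?prT ?(@clamp_ge1 (2 * a)); try lra.
rewrite -mulrBl opprD addrACA subrr add0r normrM mulrC (ger0_norm (x := 2^-1)) ?invr_ge0 //.
by rewrite ler_wpM2l ?invr_ge0.
Qed.

(** Reading one digit swaps the roles of a and c, with 2 a or 2 a - 1 in place of a. Again one of
    the two terms is known, being 0 or [pr (evenle c)], so the difference of both sides halves; the
    induction keeps a and c general because of the swap. *)
Lemma pr_evenle_oddle a c : pr (evenle a `&` oddle c) = clamp a * clamp c.
Proof.
have mEO a' c' : measurable (evenle a' `&` oddle c').
  by apply: measurableI; [exact: measurable_evenle|exact: measurable_oddle].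
apply: eq_of_half_powers => n; elim: n a c => [|n IH] a c.
  have /andP[ca0 ca1] := clamp_itv a; have /andP[cc0 cc1] := clamp_itv c.
  have : 0 <= clamp a * clamp c <= 1 by rewrite mulr_ge0 // mulr_ile1.
  have := pr_ge0 (evenle a `&` oddle c); have := pr_le1 (mEO a c).
  by rewrite expr0 ler_norml; lra.
have -> : pr (evenle a `&` oddle c) =
    (pr (evenle c `&` oddle (2 * a)) + pr (evenle c `&` oddle (2 * a - 1))) / 2.
  apply: pr_dbl_cases => // u; have := evenleE a u.
  by case: (high u) => E; split=> -[h1 h2]; split=> //; apply/E.
rewrite (clamp_double a) exprS.
have half z w : `|z - w| <= 2^-1 ^+ n -> `|z / 2 - w / 2| <= 2^-1 * 2^-1 ^+ n :> R.
  move=> h; rewrite -mulrBl normrM mulrC (ger0_norm (x := 2^-1)) ?invr_ge0 //.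
  by rewrite ler_wpM2l ?invr_ge0.
have [a2|a2] := ltP (2 * a - 1) 0.
  rewrite (@oddle_lt0 (_ - 1)) // setI0 pr0 (@clamp_lt0 (_ - 1)) ?(ltW a2) // !addr0.
  by rewrite mulrAC; apply: half; rewrite [clamp (2 * a) * _]mulrC; exact: IH.
rewrite (@oddle_ge1 (2 * a)) ?(@clamp_ge1 (2 * a)); try lra.
rewrite setIT pr_evenle mulrAC; apply: half.
rewrite [(1 + clamp _) * _]mulrDl mul1r opprD addrACA subrr add0r [clamp (2 * a - 1) * _]mulrC.
exact: IH.
Qed.

(** Arbitrary Borel sets are needed in the odd digits, since the whole rest of the limit sequence is
    a function of them. *)
Lemma pr_evenle_oddbits a B : measurable B ->
  pr (evenle a `&` oddbits @^-1` B) = clamp a * pr B.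
Proof.
apply: pr_of_rays.
- exact: measurable_evenle.
- exact: measurable_oddbits.
- exact: (andP (clamp_itv a)).1.
- exact: pr_evenle.
- exact: pr_evenle_oddle.
Qed.

End UniformBits.

(** * The limit variables *)

Section LimitVariables.
Variables (R : realType) (sigma : R).
Hypothesis hsigma : 1 <= sigma.
Local Notation T := (measurableTypeR R).

Let sigma_gt0 : 0 < sigma. Proof. exact: lt_le_trans hsigma. Qed.

Lemma Gcdf_itv a : 0 <= a <= 1 -> 0 <= Gcdf sigma a <= 1.
Proof.
move=> /andP[a0 a1]; have p0 : 0 <= sigma / 2 by rewrite divr_ge0 // ltW.
have h1 : (1 - a) `^ (sigma / 2) <= 1 `^ (sigma / 2) by apply: powR_le_mono => //; lra.
have h0 := powR_ge0 (1 - a) (sigma / 2).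
by rewrite /Gcdf; move: h1; rewrite powR1; lra.
Qed.

(** The inverse of [Gcdf] on [0, 1], which turns a uniform variable into a beta(1, sigma / 2)
    one. *)
Definition quantile (v : R) : R := 1 - (1 - v) `^ (2 / sigma).

Lemma quantile_itv v : 0 <= v <= 1 -> 0 <= quantile v <= 1.
Proof.
move=> /andP[v0 v1]; have p0 : 0 <= 2 / sigma by rewrite divr_ge0 // ltW.
have h1 : (1 - v) `^ (2 / sigma) <= 1 `^ (2 / sigma) by apply: powR_le_mono => //; lra.
have h0 := powR_ge0 (1 - v) (2 / sigma).
by rewrite /quantile; move: h1; rewrite powR1; lra.
Qed.

Lemma quantile_le v a : 0 <= v <= 1 -> 0 <= a <= 1 ->
  (quantile v <= a) = (v <= Gcdf sigma a).
Proof.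
move=> /andP[v0 v1] /andP[a0 a1]; rewrite /quantile /Gcdf.
have p0 : 0 <= 2 / sigma by rewrite divr_ge0 // ltW.
have q0 : 0 <= sigma / 2 by rewrite divr_ge0 // ltW.
have pq : 2 / sigma * (sigma / 2) = 1 by field; rewrite gt_eqF.
set z := 1 - a; set w := 1 - v.
have z0 : 0 <= z by rewrite subr_ge0.
have w0 : 0 <= w by rewrite subr_ge0.
apply/idP/idP => h.
  have zw : z <= w `^ (2 / sigma) by rewrite /z; lra.
  have := powR_le_mono q0 z0 zw; rewrite -powRrM pq powRr1 //.
  by rewrite /w; lra.
have zw : z `^ (sigma / 2) <= w by rewrite /w; lra.
have := powR_le_mono p0 (powR_ge0 _ _) zw; rewrite -powRrM mulrC pq powRr1 //.
by rewrite /z; lra.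
Qed.

Lemma measurable_quantile : measurable_fun setT quantile.
Proof.
apply: measurable_funB; first exact: measurable_cst.
apply: (measurableT_comp (measurable_powR _)).
by apply: measurable_funB => //; exact: measurable_cst.
Qed.

Definition survives (u : T) : bool := ((evenbits u : R) <= sigma^-1).

(* A single uniform variable decides whether the sequence goes on and, if so,
   provides the next value: conditioned on v <= 1 / sigma, sigma * v is uniform. *)
Fixpoint later_hike (j : nat) (u : T) : R :=
  if survives u then
    if j is i.+1 then later_hike i (oddbits u) else quantile (sigma * (evenbits u : R))
  else 0.

Definition limit_hike (j : nat) (u : T) : R :=
  if j is i.+1 then later_hike i (oddbits u) else quantile (evenbits u).

Lemma survives_itv u : survives u -> 0 <= sigma * (evenbits u : R) <= 1.
Proof.
rewrite /survives => h; have /andP[e0 _] := evenbits_itv u.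
by rewrite mulr_ge0 ?(ltW sigma_gt0) //= mulrC -ler_pdivlMr // div1r.
Qed.

Lemma later_hike_itv j u : 0 <= later_hike j u <= 1.
Proof.
by elim: j u => [|j IH] u /=; case: ifP => // s; rewrite ?lexx ?ler01 //;
  apply: quantile_itv; exact: survives_itv.
Qed.

Lemma limit_hike_itv j u : 0 <= limit_hike j u <= 1.
Proof.
by case: j => [|j]; [apply: quantile_itv; exact: evenbits_itv|exact: later_hike_itv].
Qed.

Lemma measurable_later_hike j : measurable_fun setT (later_hike j).
Proof.
have ms : measurable_fun setT survives.
  by apply: measurable_fun_ler; [exact: measurable_evenbits|exact: measurable_cst].
elim: j => [|j IH] /=; apply: measurable_fun_ifT => //; try exact: measurable_cst.
- apply: (measurableT_comp measurable_quantile).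
  by apply: measurable_funM; [exact: measurable_cst|exact: measurable_evenbits].
- exact: (measurableT_comp IH (@measurable_oddbits R)).
Qed.

Lemma measurable_limit_hike j : measurable_fun setT (limit_hike j).
Proof.
case: j => [|j].
  exact: (measurableT_comp measurable_quantile (@measurable_evenbits R)).
exact: (measurableT_comp (measurable_later_hike j) (@measurable_oddbits R)).
Qed.

Let later_le n (alpha : nat -> R) : set T :=
  [set u | forall i, (i < n)%N -> later_hike i u <= alpha i].

(** Either [evenbits u <= G / sigma], which is survival with a first value within its level, and the
    independent rest goes by induction; or the sequence has stopped, and its zeros meet all levels.
    These are the two terms of the bracket in [limit_cdf]. *)
Lemma pr_later_hike n (alpha : nat -> R) :
  (forall i, (i < n)%N -> 0 <= alpha i <= 1) ->
  pr (later_le n alpha) = limit_cdf sigma (mkseq alpha n) / sigma + (1 - sigma^-1).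
Proof.
have s0 : sigma != 0 by rewrite gt_eqF.
elim: n alpha => [|n IH] alpha a01.
  rewrite (_ : later_le _ _ = setT) ?prT /=; first by field.
  by apply/seteqP; split => // u _.
have mB : measurable (later_le n (alpha \o S)).
  by apply: measurable_forall_le => i; exact: measurable_later_hike.
have mE a : measurable [set u | (evenbits u : R) <= a] by exact: measurable_evenle.
have a0 : 0 <= alpha 0%N <= 1 by exact: a01.
have /andP[G0 G1] := Gcdf_itv a0; set G := Gcdf _ _ in G0 G1.
have V0 : 0 <= sigma^-1 by rewrite invr_ge0 ltW.
have V1 : sigma^-1 <= 1 by rewrite invf_le1.
have GV0 : 0 <= G / sigma by rewrite divr_ge0 // ltW.
have GV : G / sigma <= sigma^-1 by rewrite ler_piMl.
have -> : later_le n.+1 alpha =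
    ([set u | (evenbits u : R) <= G / sigma] `&` (@oddbits R) @^-1` later_le n (alpha \o S))
    `|` ~` [set u | (evenbits u : R) <= sigma^-1].
  apply/seteqP; split => u /=.
    move=> h; have [su|su] := boolP (survives u); last by right; apply/negP.
    left; split=> [|i it].
      have := h 0%N isT; rewrite /= su quantile_le ?survives_itv // -/G.
      by rewrite ler_pdivlMr // mulrC.
    by have := h i.+1 it; rewrite /= su.
  case=> [[h1 h2] [|i] it|/negP/negbTE su [|i] it] /=; rewrite /survives.
  - rewrite (le_trans h1 GV) quantile_le // -/G; first by rewrite mulrC -ler_pdivlMr.
    by apply: survives_itv; rewrite /survives (le_trans h1 GV).
  - by rewrite (le_trans h1 GV); exact: h2.
  - by rewrite su; case/andP: (a01 _ it).
  - by rewrite su; case/andP: (a01 _ it).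
have mO := measurable_preimage (@measurable_oddbits R) mB.
rewrite prU; [|by apply: measurableI|exact: measurableC|]; last first.
  by apply/disj_set2P/seteqP; split => // u /= [[h _]]; apply; exact: le_trans GV.
rewrite pr_evenle_oddbits // clamp_id ?(le_trans GV) //.
have -> : pr (~` [set u | (evenbits u : R) <= sigma^-1]) = 1 - sigma^-1.
  apply: EFin_inj; rewrite EFinB -prE; last exact: measurableC.
  by rewrite probability_setC // prE // pr_evenle clamp_id.
rewrite IH; last by move=> i it; exact: a01.
by rewrite mkseq_cons /= -/G mulrAC.
Qed.

Lemma pr_limit_hike n (alpha : nat -> R) :
  (forall i, (i < n)%N -> 0 <= alpha i <= 1) ->
  pr [set u | forall i, (i < n)%N -> limit_hike i u <= alpha i] =
  limit_cdf sigma (mkseq alpha n).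
Proof.
case: n => [|n] a01.
  by rewrite (_ : mkset _ = setT) ?prT //; apply/seteqP; split => // u _.
have mB : measurable (later_le n (alpha \o S)).
  by apply: measurable_forall_le => i; exact: measurable_later_hike.
have a0 : 0 <= alpha 0%N <= 1 by exact: a01.
have /andP[G0 G1] := Gcdf_itv a0.
have -> : [set u | forall i, (i < n.+1)%N -> limit_hike i u <= alpha i] =
    [set u | (evenbits u : R) <= Gcdf sigma (alpha 0%N)]
    `&` (@oddbits R) @^-1` later_le n (alpha \o S).
  apply/seteqP; split => u /=.
    move=> h; split=> [|i it]; last exact: (h i.+1 it).
    by have := h 0%N isT; rewrite /= quantile_le ?evenbits_itv.
  by case=> h1 h2 [|i] it /=; [rewrite quantile_le ?evenbits_itv|exact: h2].
rewrite pr_evenle_oddbits // clamp_id // pr_later_hike ?mkseq_cons //.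
by move=> i it; exact: a01.
Qed.

Lemma xi_cdfE n (alpha : nat -> R) : (1 <= n)%N ->
  xi_cdf sigma n alpha = limit_cdf sigma (mkseq alpha n).
Proof.
have s0 : sigma != 0 by rewrite gt_eqF.
pose P m (b : nat -> R) : R := \prod_(i < m) Gcdf sigma (b i).
have PS m b : P m.+1 b = Gcdf sigma (b 0%N) * P m (b \o S).
  by rewrite /P big_ord_recl.
have xiE m b : xi_cdf sigma m.+1 b =
    sigma ^- m * P m.+1 b + (sigma - 1) * \sum_(0 <= j < m) sigma ^- j.+1 * P j.+1 b.
  (* Reversing the sum makes the number of factors the summation index, which suits a recursion on
     the first variable. *)
  rewrite /xi_cdf /=; congr (_ + _ * _); rewrite big_nat_rev big_add1 /=.
  apply: eq_big_nat => j /andP[_ jm].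
  by rewrite (_ : (m.+1 - (1 + m.+1 - j.+2) = j.+1)%N) //; lia.
case: n => // n _; rewrite xiE; elim: n alpha => [|n IH] b.
  rewrite big_geq // mulr0 addr0 expr0 invr1 mul1r PS /P big_ord0 /= mulr1.
  by field.
have -> : limit_cdf sigma (mkseq b n.+2) = Gcdf sigma (b 0%N) *
    (limit_cdf sigma (mkseq (b \o S) n.+1) / sigma + (1 - sigma^-1)).
  by rewrite mkseq_cons.
rewrite -IH.
have -> : \sum_(0 <= j < n.+1) sigma ^- j.+1 * P j.+1 b = Gcdf sigma (b 0%N) *
    (sigma^-1 + sigma^-1 * \sum_(0 <= j < n) sigma ^- j.+1 * P j.+1 (b \o S)).
  rewrite big_nat_recl // expr1 PS /P big_ord0 mulr1 mulrC mulrDr; congr (_ + _).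
  rewrite !mulr_sumr; apply: eq_bigr => j _; rewrite -!/(P _ _) PS (exprS sigma j.+1) invfM.
  by ring.
rewrite PS exprS invfM; set Q := \sum_(_ <= _ < _) _; set p := P _ _.
by field; rewrite s0 expf_neq0.
Qed.

End LimitVariables.

(** * Weak convergence from distribution functions *)

Section BoundedMeasurable.
Context d (T : measurableType d) (R : realType) (P : probability T R).
Implicit Types g h : T -> R.

Definition bounded_measurable g : Prop :=
  measurable_fun setT g /\ exists C, forall t, `|g t| <= C.

Lemma bounded_measurable_integrable g : bounded_measurable g ->
  P.-integrable setT (EFin \o g).
Proof.
move=> [mg [C hC]]; apply: measurable_bounded_integrable => //.
  exact: le_lt_trans (probability_le1 P measurableT) (ltry _).
by exists C; split; [rewrite num_real|move=> M CM t _; apply: le_trans (ltW CM)].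
Qed.

Lemma bounded_measurableD g h : bounded_measurable g -> bounded_measurable h ->
  bounded_measurable (fun t => g t + h t).
Proof.
move=> [mg [C hC]] [mh [D hD]]; split; first exact: measurable_funD.
by exists (C + D) => t; rewrite (le_trans (ler_normD _ _)) // lerD.
Qed.

Lemma bounded_measurableZ (k : R) g : bounded_measurable g ->
  bounded_measurable (fun t => k * g t).
Proof.
move=> [mg [C hC]]; split; first by apply: measurable_funM => //; exact: measurable_cst.
by exists (`|k| * C) => t; rewrite normrM ler_wpM2l.
Qed.

Lemma bounded_measurable_cst (k : R) : bounded_measurable (fun=> k).
Proof. by split; [exact: measurable_cst|exists `|k|]. Qed.

Lemma bounded_measurable_sum (I : Type) (r : seq I) (g : I -> T -> R) :
  (forall i, bounded_measurable (g i)) ->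
  bounded_measurable (fun t => \sum_(i <- r) g i t) /\
  (\int[P]_t (\sum_(i <- r) g i t) = \sum_(i <- r) \int[P]_t g i t)%R.
Proof.
move=> hg; elim: r => [|i r [IH1 IH2]].
  rewrite big_nil; under eq_fun do rewrite big_nil.
  split; first exact: bounded_measurable_cst.
  by rewrite Rintegral_cst // mul0r.
rewrite big_cons; under eq_fun do rewrite big_cons.
split; first exact: bounded_measurableD.
by rewrite RintegralD ?IH2 //; exact: bounded_measurable_integrable.
Qed.

Lemma Rintegral_bool (b : T -> bool) : measurable [set t | b t] ->
  bounded_measurable (fun t => (b t)%:R) /\
  (\int[P]_t (b t)%:R)%R = fine (P [set t | b t]).
Proof.
move=> mb.
have -> : (fun t => (b t)%:R) = \1_[set t | b t] :> (T -> R).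
  apply/funext => t; rewrite indicE; congr (_%:R); congr nat_of_bool.
  by apply/idP/idP; rewrite inE.
split; last by rewrite /Rintegral integral_indic // setIT.
split; first exact: measurable_indic.
by exists 1 => t; rewrite indicE normr_nat lern1 leq_b1.
Qed.

Lemma Rintegral_close g h e : bounded_measurable g -> bounded_measurable h ->
  (forall t, `|g t - h t| <= e) -> `|\int[P]_t g t - \int[P]_t h t|%R <= e.
Proof.
move=> bg bh gh; have ig := bounded_measurable_integrable bg.
have ih := bounded_measurable_integrable bh.
have bd : bounded_measurable (fun t => g t - h t).
  have := bounded_measurableD bg (bounded_measurableZ (-1) bh).
  by under eq_fun do rewrite mulN1r.
have bn : bounded_measurable (fun t => `|g t - h t|).
  split; last by exists e => t; rewrite normr_id.
  by apply: measurableT_comp => //; exact: bd.1.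
rewrite -RintegralB //.
apply: (le_trans (le_normr_Rintegral measurableT (bounded_measurable_integrable bd))).
have -> : e = (\int[P]_t (fun=> e) t)%R.
  rewrite Rintegral_cst // -[LHS]mulr1; congr (_ * _).
  exact/esym/(congr1 fine (probability_setT P)).
apply: le_Rintegral => //; apply: bounded_measurable_integrable => //.
exact: bounded_measurable_cst.
Qed.

End BoundedMeasurable.

(** * Approximation of continuous functions on the cube by combinations of boxes *)

Section Grid.
Variables (R : realType) (k : nat).
Implicit Types (v : 'rV[R]_k) (alpha : nat -> R) (f : 'rV[R]_k -> R).

Definition box alpha v : bool := [forall j : 'I_k, v 0 j <= alpha j].

Definition in_cube v : Prop := forall j, 0 <= v 0 j <= 1.

Section GridSize.
Variable m : nat.
Let N : R := m.+1%:R.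

Let N_gt0 : 0 < N. Proof. by rewrite ltr0n. Qed.

Definition ray_level (i : 'I_m.+1) (s : bool) : R :=
  if s then i.+1%:R / N else if (0 < i)%N then i%:R / N else 1.

Definition ray_sign (i : 'I_m.+1) (s : bool) : R :=
  if s then 1 else if (0 < i)%N then - 1 else 0.

(* For z >= 0, [cell i z] is the indicator of i / N < z <= (i + 1) / N, where the
   strict inequality is dropped when i = 0; see [cellE]. *)
Definition cell (i : 'I_m.+1) (z : R) : R :=
  \sum_(s : bool) ray_sign i s * (z <= ray_level i s)%R%:R.

Lemma ray_level_itv i s : 0 < ray_level i s <= 1.
Proof.
rewrite /ray_level; case: s; last case: posnP => i0; rewrite ?ltr01 ?lexx //.
  by rewrite divr_gt0 //= ler_pdivrMr // mul1r ler_nat.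
by rewrite divr_gt0 ?ltr0n //= ler_pdivrMr // mul1r ler_nat ltnW.
Qed.

Lemma cellE (i : 'I_m.+1) z : 0 <= z ->
  cell i z = ((z <= i.+1%:R / N) && ((i == 0%N :> nat) || (i%:R / N < z)))%:R.
Proof.
move=> z0; rewrite /cell big_bool /= mul1r /ray_level /ray_sign /=.
case: posnP => [->|i0] /=; first by rewrite mul0r addr0 andbT.
rewrite mulN1r; have [zi|zi] := leP z (i%:R / N).
  by rewrite andbF (le_trans zi) ?subrr // ler_pM2r ?invr_gt0 // ler_nat.
by rewrite andbT subr0.
Qed.

Lemma sum_cell z : 0 <= z <= 1 -> \sum_i cell i z = 1.
Proof.
move=> /andP[z0 z1].
pose F (i : nat) : R := if i is 0 then 0 else (z <= i%:R / N)%R%:R.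
rewrite (eq_bigr (fun i : 'I_m.+1 => F i.+1 - F i)) => [|i _]; last first.
  rewrite /cell big_bool /= mul1r /ray_level /ray_sign /=.
  by case: i => -[|i] i_lt /=; rewrite ?mul0r ?subr0 ?addr0 // mulN1r.
by rewrite -(big_mkord xpredT (fun i => F i.+1 - F i)) telescope_sumr //= divff ?gt_eqF // z1 subr0.
Qed.

Lemma cell_close (i : 'I_m.+1) z : 0 <= z -> cell i z != 0 ->
  `|z - i.+1%:R / N| <= N^-1.
Proof.
move=> z0; rewrite cellE //; case: andP => [[h1 h2] _|_]; last by rewrite eqxx.
have iN : i.+1%:R / N = i%:R / N + N^-1 by rewrite -natr1 mulrDl mul1r.
have iz : i%:R / N <= z.
  by case/orP: h2 => [/eqP ->|/ltW //]; rewrite mul0r.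
have N0 : 0 <= N^-1 by rewrite invr_ge0 ltW.
move: h1 iz N0; rewrite ler_norml iN; move: (i%:R / N) N^-1 => A B *; lra.
Qed.

Definition gridpoint (c : {ffun 'I_k -> 'I_m.+1}) : 'rV[R]_k :=
  \row_j ((c j).+1%:R / N).

Lemma gridpoint_cube c : in_cube (gridpoint c).
Proof.
move=> j; rewrite mxE; have /andP[/ltW ? ?] := ray_level_itv (c j) true.
exact/andP.
Qed.

Definition step f v : R :=
  \sum_(c : {ffun 'I_k -> 'I_m.+1}) f (gridpoint c) * \prod_j cell (c j) (v 0 j).

(** On the cube the products of cells are nonnegative weights of sum 1, so the difference is an
    average of [f v - f p] over the grid points p of nonzero weight, all within 1 / N of v. *)
Lemma step_close f v e : in_cube v ->
  (forall p, in_cube p -> (forall j, `|v 0 j - p 0 j| <= N^-1) -> `|f v - f p| <= e) ->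
  `|f v - step f v| <= e.
Proof.
move=> v01 H.
have cell0 (i : 'I_m.+1) j : 0 <= cell i (v 0 j).
  by have /andP[v0 _] := v01 j; rewrite cellE.
have one : \sum_(c : {ffun 'I_k -> 'I_m.+1}) \prod_j cell (c j) (v 0 j) = 1.
  rewrite -(bigA_distr_bigA (fun j i => cell i (v 0 j))).
  by apply: big1 => j _; exact: sum_cell.
have weighted y : y = \sum_(c : {ffun 'I_k -> 'I_m.+1}) y * \prod_j cell (c j) (v 0 j).
  by rewrite -mulr_sumr one mulr1.
rewrite [f v]weighted /step -sumrB (le_trans (ler_norm_sum _ _ _)) //.
rewrite [leRHS]weighted; apply: ler_sum => c _.
have pc0 : 0 <= \prod_j cell (c j) (v 0 j) by apply: prodr_ge0.
rewrite -mulrBl normrM (ger0_norm pc0).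
have [->|pc] := eqVneq (\prod_j cell (c j) (v 0 j)) 0; first by rewrite !mulr0.
rewrite ler_wpM2r // H //; first exact: gridpoint_cube.
move=> j; rewrite mxE; apply: cell_close; first by case/andP: (v01 j).
by move/prodf_neq0 : pc; apply.
Qed.

(** The default 1 keeps the levels past k in ]0, 1] as well. *)
Definition box_level (c : {ffun 'I_k -> 'I_m.+1}) (s : {ffun 'I_k -> bool}) (n : nat) : R :=
  if insub n is Some j then ray_level (c j) (s j) else 1.

Lemma box_level_itv c s n : 0 < box_level c s n <= 1.
Proof.
rewrite /box_level; case: insub => [j|]; first exact: ray_level_itv.
by rewrite ltr01 lexx.
Qed.

(** Inclusion-exclusion: the product of differences of rays is expanded over the 2^k choices of
    [s]. *)
Lemma step_box f v : step f v =
  \sum_(c : {ffun 'I_k -> 'I_m.+1}) \sum_(s : {ffun 'I_k -> bool})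
    f (gridpoint c) * \prod_j ray_sign (c j) (s j) * (box (box_level c s) v)%:R.
Proof.
apply: eq_bigr => c _; rewrite /cell.
rewrite (bigA_distr_bigA (fun j s => ray_sign (c j) s * (v 0 j <= ray_level (c j) s)%R%:R)).
rewrite mulr_sumr; apply: eq_bigr => s _; rewrite big_split /= mulrA; congr (_ * _).
rewrite /box; case: forallP => h.
  by rewrite big1 // => j _; have := h j; rewrite /box_level valK => ->.
have [j /negbTE hj] : exists j, ~~ (v 0 j <= box_level c s j).
  by apply/existsP; rewrite -negb_forall; apply/forallP.
by rewrite (bigD1 j) //=; move: hj; rewrite /box_level valK => ->; rewrite mul0r.
Qed.

End GridSize.

(** Continuity at v gives a ball of radius r; if w is within r / 2 of v and p within r / 2 of w,
    both lie in it. So one m serves all points near v, and compactness of the cube makes it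
    uniform. *)
Lemma cube_uniformly_continuous f (e : R) : continuous f -> 0 < e ->
  \forall m \near \oo, forall v, in_cube v -> forall p : 'rV[R]_k,
    (forall j, `|v 0 j - p 0 j| <= m.+1%:R^-1) -> `|f v - f p| <= e.
Proof.
move=> cf e0.
have cK : compact [set v : 'rV[R]_k | forall j, `[0, 1]%classic (v 0 j)].
  by apply: (@rV_compact R k (fun=> `[0, 1]%classic)) => j; exact: segment_compact.
pose close m v := forall p : 'rV[R]_k,
  (forall j, `|v 0 j - p 0 j| <= m.+1%:R^-1) -> `|f v - f p| <= e.
suff near v : \forall v' \near v & m \near \oo, close m v'.
  have H : \forall m \near \oo,
      [set v : 'rV[R]_k | forall j, `[0, 1]%classic (v 0 j)] `<=` close m.
    by apply: ((compact_near_coveringP _).1 cK nat \oo close _) => v _; exact: near.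
  apply: filterS H => m hm v v01; apply: hm => j.
  by rewrite /= in_itv /=; exact: v01.
have /cvgrPdist_lt/(_ (e / 2)) := cf v; rewrite divr_gt0 // => /(_ isT).
move=> /nbhs_ballP[r /= r0 hr].
have r20 : 0 < r / 2 by rewrite divr_gt0.
exists (ball v (r / 2), [set m | m.+1%:R^-1 < r / 2]).
  split => /=; first exact: nbhsx_ballx.
  exact: (near_infty_natSinv_lt (PosNum r20)).
move=> [w m] /= [[_ hw] hm] p hp.
have fw : `|f v - f w| < e / 2.
  apply: hr; split=> // i j; apply: (le_ball _ (hw i j)).
  by lra.
have fp : `|f v - f p| < e / 2.
  apply: hr; split=> // i j; rewrite (splitr r); apply: (ball_triangle (hw i j)).
  by rewrite ord1 /ball /= (le_lt_trans (hp j)).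
rewrite (_ : f w - f p = (f v - f p) - (f v - f w)); last by ring.
by rewrite (le_trans (ler_normB _ _)) // [leRHS]splitr lerD // ltW.
Qed.

End Grid.

Lemma cvg_sum_seq (R : realType) (I : Type) (r : seq I) (u : I -> nat -> R) (l : I -> R) :
  (forall i, u i n @[n --> \oo] --> l i) ->
  \sum_(i <- r) u i n @[n --> \oo] --> \sum_(i <- r) l i.
Proof.
move=> ul; elim: r => [|i r IH].
  by rewrite big_nil; under eq_fun do rewrite big_nil; exact: cvg_cst.
by rewrite big_cons; under eq_fun do rewrite big_cons; exact: cvgD.
Qed.

(** Replacing f by [step m f] costs at most e / 3 under each law, uniformly in n; for this fixed m
    the expectations are finite combinations of box probabilities, which converge. *)
Lemma words_cvg_of_box (R : realType) (k : nat) (M : nat -> fibword -> R)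
    (X : nat -> fibword -> 'rV[R]_k) (d : measure_display)
    (T : measurableType d) (P : probability T R) (Y : nat -> T -> R) :
  (forall n w, 0 <= M n w) -> (forall n, \sum_(w <- YF n) M n w = 1) ->
  (forall n w, weight w = n -> in_cube (X n w)) ->
  (forall j, measurable_fun setT (Y j)) -> (forall j t, 0 <= Y j t <= 1) ->
  (forall alpha : nat -> R, (forall j, 0 < alpha j <= 1) ->
    \sum_(w <- YF n) M n w * (box alpha (X n w))%:R @[n --> \oo] -->
      fine (P [set t | box alpha (\row_(j < k) Y j t)])) ->
  words_cvg_in_distribution M X P (fun t => \row_(j < k) Y j t).
Proof.
move=> M0 M1 X01 mY Y01 boxcvg f cf [C fC].
pose V t : 'rV[R]_k := \row_(j < k) Y j t.
have V01 t : in_cube (V t) by move=> j; rewrite mxE; exact: Y01.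
pose E n g : R := \sum_(w <- YF n) M n w * g (X n w).
have mbox alpha : measurable [set t | box alpha (V t)].
  have -> : [set t | box alpha (V t)] =
      [set t | forall j, (j < k)%N -> Y j t <= alpha j].
    apply/seteqP; split => t /=.
      by move=> /forallP h j jk; have := h (Ordinal jk); rewrite mxE.
    by move=> h; apply/forallP => j; rewrite mxE; exact: h.
  exact: measurable_forall_le.
have step_expand m : step m f = fun v => \sum_(c : {ffun 'I_k -> 'I_m.+1})
    \sum_(s : {ffun 'I_k -> bool}) f (gridpoint R c) * \prod_j ray_sign R (c j) (s j)
      * (box (box_level R c s) v)%:R.
  by apply/funext => v; exact: step_box.
pose K m c (s : {ffun 'I_k -> bool}) : R := f (gridpoint R c) * \prod_j @ray_sign R m (c j) (s j).
have bm_box (c : R) alpha : bounded_measurable (fun t => c * (box alpha (V t))%:R).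
  exact: bounded_measurableZ (Rintegral_bool P (mbox alpha)).1.
have bm_step m : bounded_measurable (fun t => step m f (V t)).
  rewrite step_expand; apply: (bounded_measurable_sum P _ _).1 => c.
  by apply: (bounded_measurable_sum P _ _).1 => s.
have int_step m : (\int[P]_t step m f (V t) = \sum_c \sum_s
    K m c s * fine (P [set t | box (box_level R c s) (V t)]))%R.
  rewrite step_expand (bounded_measurable_sum P _ _).2; last first.
    by move=> c; apply: (bounded_measurable_sum P _ _).1.
  apply: eq_bigr => c _; rewrite (bounded_measurable_sum P _ _).2 //.
  apply: eq_bigr => s _.
  have [bm <-] := Rintegral_bool P (mbox (box_level R c s)).
  by rewrite RintegralZl //; exact: bounded_measurable_integrable.
have step_cvg m : E n (step m f) @[n --> \oo] --> (\int[P]_t step m f (V t))%R.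
  rewrite int_step.
  have -> : (fun n => E n (step m f)) = fun n => \sum_c \sum_s
      K m c s * E n (fun v => (box (box_level R c s) v)%:R).
    apply/funext => n; rewrite /E step_expand.
    under eq_bigr => w _ do rewrite mulr_sumr.
    rewrite exchange_big; apply: eq_bigr => c _.
    under eq_bigr => w _ do rewrite mulr_sumr.
    rewrite exchange_big; apply: eq_bigr => s _.
    by rewrite mulr_sumr; apply: eq_bigr => w _; rewrite mulrCA.
  apply: cvg_sum_seq => c; apply: cvg_sum_seq => s.
  apply: cvgM; first exact: cvg_cst.
  by apply: boxcvg => j; exact: box_level_itv.
have near_step e : 0 < e -> \forall m \near \oo, forall v, in_cube v ->
    `|f v - step m f v| <= e.
  move=> e0; apply: filterS (cube_uniformly_continuous cf e0) => m h v v01.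
  by apply: step_close => // p _ hp; exact: h.
have bm_f : bounded_measurable (f \o V).
  split; last by exists C => t; exact: fC.
  apply: (measurable_fun_cvg (fun m => (bm_step m).1)) => t _.
  apply/cvgrPdist_le => e e0; apply: filterS (near_step e e0) => m; exact.
have -> : ('E_P[f \o V])%E = (\int[P]_t f (V t))%R%:E.
  rewrite unlock /Rintegral fineK //; apply: integrable_fin_num => //.
  exact: bounded_measurable_integrable.
apply: cvg_EFin; first exact: nearW.
apply/cvgrPdist_le => e e0.
have e3 : 0 < e / 3 by rewrite divr_gt0.
have [m _ /(_ m (leqnn m)) hm] := near_step _ e3.
have Eclose n : `|E n f - E n (step m f)| <= e / 3.
  rewrite -sumrB (le_trans (ler_norm_sum _ _ _)) //.
  have -> : e / 3 = \sum_(w <- YF n) M n w * (e / 3) by rewrite -mulr_suml M1 mul1r.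
  rewrite big_seq_cond [leRHS]big_seq_cond.
  apply: ler_sum => w; rewrite andbT mem_YF => /eqP wn.
  rewrite -mulrBr normrM (ger0_norm (M0 _ _)).
  by apply: ler_wpM2l; [exact: M0|apply: hm; exact: X01].
have Iclose : `|\int[P]_t f (V t) - \int[P]_t step m f (V t)|%R <= e / 3.
  by apply: Rintegral_close => // t; exact: hm.
have /cvgrPdist_le/(_ _ e3) := step_cvg m.
apply: filterS => n /= h; rewrite -/(E n f).
have := Eclose n; move: h Iclose; rewrite !ler_norml.
move: (E n f) (E n _) (\int[P]_t f (V t))%R (\int[P]_t step m f (V t))%R => a b c g.
by do 3![move=> /andP[? ?]]; apply/andP; split; lra.
Qed.

Lemma hike_ratios_box (R : realType) (k n : nat) (w : fibword) (alpha : nat -> R) :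
  weight w = n -> (forall j, 0 <= alpha j) ->
  box alpha (hike_ratios R k n w) = hikes_le (mkseq alpha k) w.
Proof.
move=> wn a0; apply/forallP/hikes_leP => // [h j jk|h j].
  by have := h (Ordinal jk); rewrite mxE -wn.
by rewrite mxE -wn; exact: (h j (ltn_ord j)).
Qed.

Theorem theorem14p4 (R : realType) (sigma : R) (hsigma : 1 <= sigma) :
  exists (d : measure_display) (T : measurableType d) (P : probability T R)
         (xi : nat -> {RV P >-> R}),
    [/\ (forall j t, 0 <= xi j t <= 1),
        (forall (n : nat) (alpha : nat -> R),
            (1 <= n)%N ->
            (forall i, (i < n)%N -> 0 <= alpha i <= 1) ->
            P [set t | forall i, (i < n)%N -> xi i t <= alpha i]
              = (xi_cdf sigma n alpha)%:E) &
        (forall x y : nat -> R,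
            (forall k, (1 <= k)%N -> y k = k%:R + sigma - 1) ->
            (forall k, (2 <= k)%N -> x k = k%:R + sigma - 1) ->
            x 1%N = sigma \/ x 1%N = 1 ->
            forall k, (1 <= k)%N ->
            words_cvg_in_distribution (cloneM x y) (hike_ratios R k)
              P (fun t => \row_(j < k) xi j t))].
Proof.
have mxi j := measurable_limit_hike sigma j.
pose xi j : {RV (@unif R) >-> R} := HB.pack (limit_hike sigma j)
  (isMeasurableFun.Build _ _ _ _ (limit_hike sigma j) (mxi j)).
exists _, _, (@unif R), xi; split.
- by move=> j t; exact: limit_hike_itv.
- move=> n alpha n1 a01; rewrite prE; last exact: measurable_forall_le.
  by rewrite xi_cdfE // -pr_limit_hike.
move=> x y hy hx hx1 k k1.
have {}hx1 : 1 <= x 1%N <= sigma by case: hx1 => ->; rewrite ?lexx ?hsigma.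
apply: (words_cvg_of_box (Y := limit_hike sigma)).
- exact: (cloneM_ge0 hsigma hy hx hx1).
- exact: (cloneM_sum hsigma hy hx hx1).
- by move=> n w <- j; rewrite mxE; exact: hike_ratio_itv.
- exact: mxi.
- by move=> j t; exact: limit_hike_itv.
move=> alpha a01.
have a0 j : 0 <= alpha j by case/andP: (a01 j) => /ltW.
have -> : [set t | box alpha (\row_(j < k) limit_hike sigma j t)] =
    [set t | forall j, (j < k)%N -> limit_hike sigma j t <= alpha j].
  apply/seteqP; split => t /=.
    by move=> /forallP h j jk; have := h (Ordinal jk); rewrite mxE.
  by move=> h; apply/forallP => j; rewrite mxE; exact: h.
rewrite -/(pr _) pr_limit_hike //; last by move=> j _; rewrite a0; case/andP: (a01 j).
have := @hikes_le_cvg R sigma (cloneM x y) hsigma (cloneM_ge0 hsigma hy hx hx1)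
  (cloneM_sum hsigma hy hx hx1) (cloneM_two hsigma hy hx hx1)
  (cloneM_one_ones_two hsigma hy hx hx1) (mkseq alpha k).
move=> /(_ _); rewrite (_ : (fun n => \sum_(w <- YF n) _) =
    (fun n => expect (cloneM x y) n (hikes_le (mkseq alpha k)))); last first.
  by apply/funext => n; apply: big_YF_weight => w wn; rewrite hike_ratios_box.
by apply=> _ /mapP[j _ ->].
Qed.
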